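(* Let $\Delta\subset\mathbb{R}^7$ be a $7$-dimensional Gorenstein simplex of degree $4$ which is not a lattice pyramid. Then $\Delta$ is unimodularly equivalent to one of the following nineteen simplices, each given as the convex hull of the listed vertices, where $\mathbf{0}$ is the origin of $\mathbb{R}^7$ and $\mathbf{e}_1,\dots,\mathbf{e}_7$ are the standard unit coordinate vectors: 1. $\mathbf{0},\mathbf{e}_1,\mathbf{e}_2,\mathbf{e}_3,\mathbf{e}_4,\mathbf{e}_5,\mathbf{e}_6,\ \mathbf{e}_1+\mathbf{e}_2+\mathbf{e}_3+\mathbf{e}_4+\mathbf{e}_5+\mathbf{e}_6+2\mathbf{e}_7$; 2. $\mathbf{0},\mathbf{e}_1,\mathbf{e}_2,\ \mathbf{e}_1+\mathbf{e}_2+2\mathbf{e}_3,\ \mathbf{e}_4,\mathbf{e}_5,\mathbf{e}_6,\ \mathbf{e}_4+\mathbf{e}_5+\mathbf{e}_6+2\mathbf{e}_7$; 3. $\mathbf{0},\mathbf{e}_1,\mathbf{e}_2,\mathbf{e}_3,\mathbf{e}_4,\ \mathbf{e}_1+\mathbf{e}_4+2\mathbf{e}_5,\ \mathbf{e}_2+\mathbf{e}_4+2\mathbf{e}_6,\ \mathbf{e}_3+\mathbf{e}_4+2\mathbf{e}_7$; 4. $\mathbf{0},\mathbf{e}_1,\mathbf{e}_2,\mathbf{e}_3,\ \mathbf{e}_2+\mathbf{e}_3+2\mathbf{e}_4,\ \mathbf{e}_1+\mathbf{e}_3+2\mathbf{e}_5,\ \mathbf{e}_1+\mathbf{e}_2+2\mathbf{e}_6,\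 \mathbf{e}_1+\mathbf{e}_2+\mathbf{e}_3+2\mathbf{e}_7$; 5. $\mathbf{0},\mathbf{e}_1,\mathbf{e}_2,\mathbf{e}_3,\mathbf{e}_4,\mathbf{e}_5,\ \mathbf{e}_1+2\mathbf{e}_6,\ \mathbf{e}_2+\mathbf{e}_3+\mathbf{e}_4+\mathbf{e}_5+2\mathbf{e}_7$; 6. $\mathbf{0},\mathbf{e}_1,\mathbf{e}_2,\mathbf{e}_3,\mathbf{e}_4,\ 2\mathbf{e}_5,\ \mathbf{e}_1+\mathbf{e}_2+2\mathbf{e}_6,\ \mathbf{e}_3+\mathbf{e}_4+2\mathbf{e}_7$; 7. $\mathbf{0},\mathbf{e}_1,\mathbf{e}_2,\mathbf{e}_3,\mathbf{e}_4,\ \mathbf{e}_1+2\mathbf{e}_5,\ \mathbf{e}_2+2\mathbf{e}_6,\ \mathbf{e}_3+\mathbf{e}_4+2\mathbf{e}_7$; 8. $\mathbf{0},\mathbf{e}_1,\mathbf{e}_2,\mathbf{e}_3,\ 2\mathbf{e}_4,\ \mathbf{e}_1+2\mathbf{e}_5,\ \mathbf{e}_1+\mathbf{e}_2+2\mathbf{e}_6,\ \mathbf{e}_1+\mathbf{e}_3+2\mathbf{e}_7$; 9. $\mathbf{0},\mathbf{e}_1,\mathbf{e}_2,\mathbf{e}_3,\mathbf{e}_4,\ 2\mathbf{e}_5,\ 2\mathbf{e}_6,\ \mathbf{e}_1+\mathbf{e}_2+\mathbf{e}_3+\mathbf{e}_4+2\mathbf{e}_7$; 10. $\mathbf{0},\mathbf{e}_1,\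 \mathbf{e}_1+2\mathbf{e}_2,\ \mathbf{e}_3,\ \mathbf{e}_3+2\mathbf{e}_4,\ \mathbf{e}_5,\ \mathbf{e}_5+2\mathbf{e}_6,\ 2\mathbf{e}_7$; 11. $\mathbf{0},\mathbf{e}_1,\mathbf{e}_2,\ 2\mathbf{e}_3,\ \mathbf{e}_2+2\mathbf{e}_4,\ \mathbf{e}_1+2\mathbf{e}_5,\ \mathbf{e}_1+\mathbf{e}_2+2\mathbf{e}_6,\ \mathbf{e}_1+\mathbf{e}_2+2\mathbf{e}_7$; 12. $\mathbf{0},\mathbf{e}_1,\mathbf{e}_2,\mathbf{e}_3,\ 2\mathbf{e}_4,\ 2\mathbf{e}_5,\ \mathbf{e}_1+2\mathbf{e}_6,\ \mathbf{e}_2+\mathbf{e}_3+2\mathbf{e}_7$; 13. $\mathbf{0},\mathbf{e}_1,\mathbf{e}_2,\ 2\mathbf{e}_3,\ 2\mathbf{e}_4,\ \mathbf{e}_1+2\mathbf{e}_5,\ \mathbf{e}_1+2\mathbf{e}_6,\ \mathbf{e}_1+\mathbf{e}_2+2\mathbf{e}_7$; 14. $\mathbf{0},\mathbf{e}_1,\mathbf{e}_2,\mathbf{e}_3,\ 2\mathbf{e}_4,\ 2\mathbf{e}_5,\ 2\mathbf{e}_6,\ \mathbf{e}_1+\mathbf{e}_2+\mathbf{e}_3+2\mathbf{e}_7$; 15. $\mathbf{0},\mathbf{e}_1,\mathbf{e}_2,\ 2\mathbf{e}_3,\ 2\mathbf{e}_4,\ 2\mathbf{e}_5,\ \mathbf{e}_1+2\mathbf{e}_6,\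 \mathbf{e}_2+2\mathbf{e}_7$; 16. $\mathbf{0},\mathbf{e}_1,\ 2\mathbf{e}_2,\ 2\mathbf{e}_3,\ 2\mathbf{e}_4,\ \mathbf{e}_1+2\mathbf{e}_5,\ \mathbf{e}_1+2\mathbf{e}_6,\ \mathbf{e}_1+2\mathbf{e}_7$; 17. $\mathbf{0},\mathbf{e}_1,\mathbf{e}_2,\ 2\mathbf{e}_3,\ 2\mathbf{e}_4,\ 2\mathbf{e}_5,\ 2\mathbf{e}_6,\ \mathbf{e}_1+\mathbf{e}_2+2\mathbf{e}_7$; 18. $\mathbf{0},\mathbf{e}_1,\ 2\mathbf{e}_2,\ 2\mathbf{e}_3,\ 2\mathbf{e}_4,\ 2\mathbf{e}_5,\ 2\mathbf{e}_6,\ \mathbf{e}_1+2\mathbf{e}_7$; 19. $\mathbf{0},\ 2\mathbf{e}_1,\ 2\mathbf{e}_2,\ 2\mathbf{e}_3,\ 2\mathbf{e}_4,\ 2\mathbf{e}_5,\ 2\mathbf{e}_6,\ 2\mathbf{e}_7$.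
   Context: A lattice polytope is a convex polytope in $\mathbb{R}^d$ all of whose vertices lie in $\mathbb{Z}^d$. Two lattice polytopes $P,Q\subset\mathbb{R}^d$ are unimodularly equivalent if $Q=f_U(P)+\mathbf{w}$ for some $\mathbf{w}\in\mathbb{Z}^d$ and some $U\in\mathbb{Z}^{d\times d}$ with $\det U=\pm1$, where $f_U(\mathbf{x})=\mathbf{x}U$. For a lattice polytope $P\subset\mathbb{R}^{d}$ of dimension $d$, $\mathrm{Pyr}(P)=\mathrm{conv}(P\times\{0\},(0,\dots,0,1))\subset\mathbb{R}^{d+1}$; a lattice polytope is a lattice pyramid if, up to unimodular equivalence, it is obtained by successively applying $\mathrm{Pyr}$ (at least once) to a lower-dimensional lattice polytope. For a $d$-dimensional lattice polytope $P\subset\mathbb{R}^d$, $\mathrm{codeg}(P)=\min\{n\in\mathbb{Z}_{>0}:\mathrm{int}(nP)\cap\mathbb{Z}^d\ne\emptyset\}$ and the degree is $\deg(P)=d+1-\mathrm{codeg}(P)$. A $d$-dimensional lattice polytope $P\subset\mathbb{R}^d$ is reflexive if the origin is in its interior and $P^\vee=\{\mathbf{y}\in\mathbb{R}^d:\langle\mathbf{x},\mathbf{y}\rangle\le1\ \forall\mathbf{x}\in P\}$ is a lattice polytope; $P$ is Gorenstein if $rP$ is unimodularly equivalent to a reflexive polytope for some integer $r\ge1$. A Gorenstein simplex is a lattice simplex that is Gorenstein. *)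

(* Defs.v *)
(* Written with MathComp and MathComp-Analysis: the real numbers are an
   arbitrary R : realType, points of R^d are row vectors 'rV[R]_d with their
   usual topology, and polytopes are classical sets of points. *)
From HB Require Import structures.
From mathcomp Require Export all_boot all_order all_algebra.
From mathcomp Require Export boolp classical_sets reals topology normedtype.

Set Implicit Arguments.
Unset Strict Implicit.
Unset Printing Implicit Defensive.

Export Order.TTheory GRing.Theory Num.Theory.
Export numFieldNormedType.Exports.

#[global] Open Scope classical_set_scope.
#[global] Open Scope ring_scope.

Section Polytopes.
Context {R : realType}.

Definition dotp d (x y : 'rV[R]_d) : R := \sum_(j < d) x 0 j * y 0 j.

Definition lattice_point d (x : 'rV[R]_d) : Prop :=
  forall j, x 0 j \is a Num.int.

Definition conv d (A : set 'rV[R]_d) : set 'rV[R]_d :=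
  [set x | exists (n : nat) (a : 'I_n -> R) (v : 'I_n -> 'rV[R]_d),
    [/\ forall i, 0 <= a i, \sum_i a i = 1, forall i, A (v i)
      & x = \sum_i a i *: v i]].

Definition affinely_independent d n (v : 'I_n -> 'rV[R]_d) : Prop :=
  forall a : 'I_n -> R,
    \sum_i a i = 0 -> \sum_i a i *: v i = 0 -> forall i, a i = 0.

(* The dimension of the affine hull of A is k; it holds of no k if A is
   empty. *)
Definition has_dim d (A : set 'rV[R]_d) (k : nat) : Prop :=
  (exists2 v : 'I_k.+1 -> 'rV[R]_d,
     affinely_independent v & forall i, A (v i)) /\
  (forall (m : nat) (v : 'I_m.+1 -> 'rV[R]_d),
     affinely_independent v -> (forall i, A (v i)) -> (m <= k)%N).

Definition polytope d (P : set 'rV[R]_d) : Prop :=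
  exists s : seq 'rV[R]_d, P = conv [set` s].

(* A vertex is a face of dimension 0: a point that is the unique maximizer on
   P of some linear functional. *)
Definition vertex d (P : set 'rV[R]_d) (v : 'rV[R]_d) : Prop :=
  P v /\
  exists c : 'rV[R]_d, forall x, P x -> x <> v -> dotp c x < dotp c v.

Definition lattice_polytope d (P : set 'rV[R]_d) : Prop :=
  polytope P /\ forall v, vertex P v -> lattice_point v.

Definition simplex d (P : set 'rV[R]_d) : Prop :=
  exists (k : nat) (v : 'I_k.+1 -> 'rV[R]_d),
    affinely_independent v /\ P = conv (range v).

Definition unimod_equiv d (P Q : set 'rV[R]_d) : Prop :=
  exists (U : 'M[int]_d) (w : 'rV[int]_d),
    (\det U = 1 \/ \det U = -1) /\
    Q = [set x *m map_mx intr U + map_mx intr w | x in P].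

Definition Pyr d (P : set 'rV[R]_d) : set 'rV[R]_(d + 1) :=
  conv ([set row_mx x 0 | x in P] `|` [set row_mx 0 1]).

Inductive iterated_Pyr k (Q : set 'rV[R]_k) :
    forall d, set 'rV[R]_d -> Prop :=
| iterated_Pyr1 : iterated_Pyr Q (Pyr Q)
| iterated_PyrS d (P : set 'rV[R]_d) :
    iterated_Pyr Q P -> iterated_Pyr Q (Pyr P).

Definition lattice_pyramid d (P : set 'rV[R]_d) : Prop :=
  lattice_polytope P /\
  exists (k : nat) (Q : set 'rV[R]_k) (P' : set 'rV[R]_d),
    [/\ lattice_polytope Q, has_dim Q k, iterated_Pyr Q P'
      & unimod_equiv P' P].

Definition dilate d (r : nat) (P : set 'rV[R]_d) : set 'rV[R]_d :=
  [set r%:R *: x | x in P].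

Definition interior_lattice_point d (P : set 'rV[R]_d) (n : nat) : Prop :=
  exists2 x, interior (dilate n P) x & lattice_point x.

(* The default value 0 is never taken when P is a full-dimensional lattice
   polytope: then codeg P lies between 1 and d.+1, so that the subtraction in
   deg is not truncated either. *)
Definition codeg d (P : set 'rV[R]_d) : nat :=
  xget 0%N [set n | [/\ (0 < n)%N, interior_lattice_point P n
    & forall m, (0 < m)%N -> interior_lattice_point P m -> (n <= m)%N]].

Definition deg d (P : set 'rV[R]_d) : nat := (d.+1 - codeg P)%N.

Definition polar d (P : set 'rV[R]_d) : set 'rV[R]_d :=
  [set y | forall x, P x -> dotp x y <= 1].

Definition reflexive_polytope d (P : set 'rV[R]_d) : Prop :=
  [/\ lattice_polytope P, has_dim P d, interior P 0 & lattice_polytope (polar P)].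

Definition gorenstein d (P : set 'rV[R]_d) : Prop :=
  [/\ lattice_polytope P, has_dim P d
    & exists (r : nat) (Q : set 'rV[R]_d),
        [/\ (1 <= r)%N, reflexive_polytope Q & unimod_equiv (dilate r P) Q]].

End Polytopes.

(* The standard unit vectors of R^7 are numbered from 1. *)
Definition unitv7 (R : realType) (i : nat) : 'rV[R]_7 :=
  \row_(j < 7) (j.+1 == i)%:R.

Definition nineteen_vertex_lists (R : realType) : seq (seq 'rV[R]_7) :=
  let e1 := unitv7 R 1 in let e2 := unitv7 R 2 in let e3 := unitv7 R 3 in
  let e4 := unitv7 R 4 in let e5 := unitv7 R 5 in let e6 := unitv7 R 6 in
  let e7 := unitv7 R 7 in
  [:: [:: 0; e1; e2; e3; e4; e5; e6; e1 + e2 + e3 + e4 + e5 + e6 + 2 *: e7];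
      [:: 0; e1; e2; e1 + e2 + 2 *: e3; e4; e5; e6; e4 + e5 + e6 + 2 *: e7];
      [:: 0; e1; e2; e3; e4; e1 + e4 + 2 *: e5; e2 + e4 + 2 *: e6;
          e3 + e4 + 2 *: e7];
      [:: 0; e1; e2; e3; e2 + e3 + 2 *: e4; e1 + e3 + 2 *: e5;
          e1 + e2 + 2 *: e6; e1 + e2 + e3 + 2 *: e7];
      [:: 0; e1; e2; e3; e4; e5; e1 + 2 *: e6; e2 + e3 + e4 + e5 + 2 *: e7];
      [:: 0; e1; e2; e3; e4; 2 *: e5; e1 + e2 + 2 *: e6; e3 + e4 + 2 *: e7];
      [:: 0; e1; e2; e3; e4; e1 + 2 *: e5; e2 + 2 *: e6; e3 + e4 + 2 *: e7];
      [:: 0; e1; e2; e3; 2 *: e4; e1 + 2 *: e5; e1 + e2 + 2 *: e6;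
          e1 + e3 + 2 *: e7];
      [:: 0; e1; e2; e3; e4; 2 *: e5; 2 *: e6; e1 + e2 + e3 + e4 + 2 *: e7];
      [:: 0; e1; e1 + 2 *: e2; e3; e3 + 2 *: e4; e5; e5 + 2 *: e6; 2 *: e7];
      [:: 0; e1; e2; 2 *: e3; e2 + 2 *: e4; e1 + 2 *: e5; e1 + e2 + 2 *: e6;
          e1 + e2 + 2 *: e7];
      [:: 0; e1; e2; e3; 2 *: e4; 2 *: e5; e1 + 2 *: e6; e2 + e3 + 2 *: e7];
      [:: 0; e1; e2; 2 *: e3; 2 *: e4; e1 + 2 *: e5; e1 + 2 *: e6;
          e1 + e2 + 2 *: e7];
      [:: 0; e1; e2; e3; 2 *: e4; 2 *: e5; 2 *: e6; e1 + e2 + e3 + 2 *: e7];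
      [:: 0; e1; e2; 2 *: e3; 2 *: e4; 2 *: e5; e1 + 2 *: e6; e2 + 2 *: e7];
      [:: 0; e1; 2 *: e2; 2 *: e3; 2 *: e4; e1 + 2 *: e5; e1 + 2 *: e6;
          e1 + 2 *: e7];
      [:: 0; e1; e2; 2 *: e3; 2 *: e4; 2 *: e5; 2 *: e6; e1 + e2 + 2 *: e7];
      [:: 0; e1; 2 *: e2; 2 *: e3; 2 *: e4; 2 *: e5; 2 *: e6; e1 + 2 *: e7];
      [:: 0; 2 *: e1; 2 *: e2; 2 *: e3; 2 *: e4; 2 *: e5; 2 *: e6; 2 *: e7]].

(* Main.v *)
From mathcomp Require Import perm fingroup.
Require Import Defs.

Set Implicit Arguments.
Unset Strict Implicit.
Unset Printing Implicit Defensive.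

(** Write H for the square matrix whose rows are (1, v_i), the v_i being the
    d + 1 vertices of a lattice simplex D.  The barycentric coordinates of x
    are the entries of (1, x) H^-1, so the whole lattice geometry of D is
    carried by H^-1.

    Suppose that r D, moved by a unimodular map, is reflexive, and let p be the
    lattice point of r D that is sent to the origin.  The facets of the
    reflexive polytope lie at lattice distance 1 from the origin, which says
    that column i of H^-1 is an integral column times b_i, where
    b = (r, p) H^-1 > 0 ([gorenstein_weights]).  Hence every 1 / b_i is a
    positive integer, every interior lattice point of n D has i-th coordinate at
    least b_i, and therefore r = sum b_i is the codegree
    ([gorenstein_codeg_weights]).

    In dimension 7 and degree 4 the codegree is 4, so eight reciprocals of
    positive integers add up to 4.  If some b_i is 1, the i-th barycentric
    coordinate is integral on the lattice and D is a lattice pyramid with apex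
    v_i ([lattice_pyramid_of_apex]).  Otherwise all the b_i are at most 1/2, and
    so equal to 1/2 ([half_weights]): 2 H^-1 is integral.

    A matrix H for which 2 H^-1 is integral is determined, up to a unimodular
    change of coordinates, by the span over F_2 of its columns
    ([unimodular_of_codes]).  This span is a binary code of length 8; it
    contains the all-ones word, which is the first column of H, and all its
    words have even weight, because the point p gives
    (1, ..., 1) H = 2 (4, p).  Up to a permutation of the eight coordinates,
    every such code is the code of one of the nineteen simplices
    ([even_code_classification]). *)

(** * Simplices in homogeneous coordinates *)

(** The leading coordinate 1 turns affine relations between the points into
    linear relations between the rows. *)
Definition hom_mx (R : nzRingType) n d (v : 'I_n -> 'rV[R]_d) :
    'M[R]_(n, 1 + d) :=
  \matrix_i row_mx 1 (v i).

Lemma mulmx_hom_mx (R : nzRingType) n d (a : 'rV[R]_n) (v : 'I_n -> 'rV[R]_d) :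
  a *m hom_mx v = row_mx (\sum_i a 0 i)%:M (\sum_i a 0 i *: v i).
Proof.
rewrite mulmx_sum_row (eq_bigr (fun i => row_mx (a 0 i)%:M (a 0 i *: v i))).
  elim/big_rec3: _ => [|i x y z _ ->]; last by rewrite add_row_mx raddfD.
  by rewrite raddf0 row_mx0.
by move=> i _; rewrite rowK scale_row_mx scalemx1.
Qed.

Lemma scalar_mx1_inj (R : realType) : injective (@scalar_mx R 1).
Proof. by move=> x y /matrixP/(_ 0 0); rewrite !mxE. Qed.

Lemma hom_mx_combination (R : realType) n d (a : 'rV[R]_n)
    (v : 'I_n -> 'rV[R]_d) (s : R) x :
  a *m hom_mx v = row_mx s%:M x ->
  \sum_i a 0 i = s /\ \sum_i a 0 i *: v i = x.
Proof.
by rewrite mulmx_hom_mx => /eq_row_mx[/scalar_mx1_inj].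
Qed.

Lemma conv_rangeP (R : realType) n d (v : 'I_n -> 'rV[R]_d) x :
  conv (range v) x <->
  exists2 a : 'rV_n, (forall i, 0 <= a 0 i) & a *m hom_mx v = row_mx 1 x.
Proof.
split=> [[m [a [u [a_ge0 a_sum uv ->]]]]|[a a_ge0 /hom_mx_combination[a1 ax]]].
  have /choice[f fE] k : exists i, v i = u k by have [i _ <-] := uv k; exists i.
  exists (\row_i \sum_(k | f k == i) a k) => [i|].
    by rewrite mxE sumr_ge0.
  rewrite mulmx_hom_mx; congr row_mx.
    suff -> : \sum_i (\row_i \sum_(k | f k == i) a k) 0 i = 1 by [].
    rewrite -a_sum [RHS](partition_big f predT) //=.
    by apply: eq_bigr => i _; rewrite mxE.
  rewrite [RHS](partition_big f predT) //=; apply: eq_bigr => i _.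
  rewrite mxE scaler_suml; apply: eq_bigr => k /eqP <-.
  by rewrite fE.
by exists n, (a 0), v; split=> // i; exists i.
Qed.

Lemma conv_sub_range (R : realType) n d (v : 'I_n -> 'rV[R]_d)
    (A : set 'rV[R]_d) :
  A `<=` conv (range v) -> conv A `<=` conv (range v).
Proof.
move=> Av x [m [a [u [a_ge0 a_sum uA ->]]]].
have /choice[f fE] k : exists b : 'rV[R]_n,
    (forall i, 0 <= b 0 i) /\ b *m hom_mx v = row_mx 1 (u k).
  by have /Av/conv_rangeP[b b_ge0 bE] := uA k; exists b.
apply/conv_rangeP; exists (\sum_k a k *: f k) => [i|].
  rewrite summxE sumr_ge0 // => k _; rewrite mxE mulr_ge0 //.
  by case: (fE k).
rewrite mulmx_suml (eq_bigr (fun k => row_mx (a k)%:M (a k *: u k)));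
  last first.
  move=> k _; rewrite -scalemxAl; case: (fE k) => _ ->.
  by rewrite scale_row_mx scalemx1.
rewrite -[X in row_mx X _]/((1 : R)%:M) -a_sum.
elim/big_rec3: _ => [|i y1 y2 y3 _ ->]; last by rewrite add_row_mx raddfD.
by rewrite raddf0 row_mx0.
Qed.

Lemma sub_conv (R : realType) d (A : set 'rV[R]_d) : A `<=` conv A.
Proof.
move=> x Ax; exists 1%N, (fun=> 1), (fun=> x).
by split=> //; rewrite big_ord1 ?scale1r.
Qed.

Lemma conv_mono (R : realType) d (A B : set 'rV[R]_d) :
  A `<=` B -> conv A `<=` conv B.
Proof.
move=> AB x [m [a [u [a_ge0 a_sum uA ->]]]].
by exists m, a, u; split=> // i; apply: AB.
Qed.

(** A linear functional takes on a convex combination an average of its values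
    on the points combined, so that its strict maximum over the hull can only
    be at one of these points. *)
Lemma vertex_conv (R : realType) d (A : set 'rV[R]_d) x :
  vertex (conv A) x -> A x.
Proof.
case=> [[m [a [u [a_ge0 a_sum uA xE]]]] [c c_max]]; apply: contrapT => nAx.
have lt_u k : dotp c (u k) < dotp c x.
  by apply: c_max => [|ukx]; [exact/sub_conv | apply: nAx; rewrite -ukx].
have cxE : dotp c x = \sum_k a k * dotp c (u k).
  rewrite /dotp xE (eq_bigr (fun j => \sum_k a k * (c 0 j * u k 0 j))).
    by rewrite exchange_big; apply: eq_bigr => k _; rewrite mulr_sumr.
  move=> j _; rewrite summxE mulr_sumr; apply: eq_bigr => k _.
  by rewrite mxE mulrCA.
have: \sum_k a k * (dotp c x - dotp c (u k)) = 0.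
  rewrite (eq_bigr (fun k => a k * dotp c x - a k * dotp c (u k))).
    by rewrite sumrB -mulr_suml a_sum mul1r -cxE subrr.
  by move=> k _; rewrite mulrBr.
move/psumr_eq0P => sum0.
have a0 k : a k = 0.
  have /eqP : a k * (dotp c x - dotp c (u k)) = 0.
    by apply: sum0 => // l _; rewrite mulr_ge0 // subr_ge0 ltW.
  by rewrite mulf_eq0 subr_eq0 (gt_eqF (lt_u k)) orbF => /eqP.
by move: a_sum; rewrite big1 // => /esym/eqP; rewrite oner_eq0.
Qed.

Lemma lattice_polytope_conv_range (R : realType) n d (v : 'I_n -> 'rV[R]_d) :
  (forall i, lattice_point (v i)) -> lattice_polytope (conv (range v)).
Proof.
move=> v_int; split=> [|x /vertex_conv[i _ <-] //].
exists [seq v i | i : 'I_n]; congr conv; apply/seteqP; split=> x /=.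
  by case=> i _ <-; rewrite map_f ?mem_enum.
by case/mapP=> i _ ->; exists i.
Qed.

Lemma affinely_independentP (R : realType) n d (v : 'I_n -> 'rV[R]_d) :
  affinely_independent v <-> row_free (hom_mx v).
Proof.
split=> [v_ind|v_free a a0 av0 i].
  rewrite -kermx_eq0; apply/eqP/row_matrixP => k; rewrite row0.
  have : row k (kermx (hom_mx v)) *m hom_mx v = row_mx 0%:M 0.
    by rewrite -row_mul mulmx_ker row0 raddf0 row_mx0.
  case/hom_mx_combination => sum0 comb0; apply/rowP => i.
  by rewrite [RHS]mxE; apply: v_ind sum0 comb0 i.
have /(row_free_inj v_free)/rowP/(_ i) :
    (\row_i a i) *m hom_mx v = 0 *m hom_mx v.
  rewrite mul0mx mulmx_hom_mx (eq_bigr a) ?a0 => [|j _]; last by rewrite mxE.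
  rewrite (eq_bigr (fun i => a i *: v i)) ?av0 => [|j _]; last by rewrite mxE.
  by rewrite raddf0 row_mx0.
by rewrite !mxE.
Qed.

Lemma has_dim_conv_range (R : realType) n d (v : 'I_n -> 'rV[R]_d) :
  n = d.+1 -> affinely_independent v -> has_dim (conv (range v)) d.
Proof.
move=> n_eq v_ind; subst n; split.
  by exists v => // i; apply: sub_conv; exists i.
move=> m w /affinely_independentP; rewrite /row_free => /eqP w_free _.
by have := rank_leq_col (hom_mx w); rewrite w_free add1n.
Qed.

Lemma simplex_vertices (R : realType) d (P : set 'rV[R]_d) :
  simplex P -> has_dim P d ->
  exists2 v : 'I_(1 + d) -> 'rV[R]_d, hom_mx v \in unitmx & P = conv (range v).
Proof.
case=> k [v [v_ind PE]] [[w w_ind wP] dimP].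
have le_kd : (k <= d)%N.
  by apply: dimP v_ind _ => i; rewrite PE; apply: sub_conv; exists i.
have le_dk : (d <= k)%N.
  move/affinely_independentP: w_ind; rewrite /row_free -ltnS => /eqP rank_w.
  rewrite -[X in (X <= _)%N]rank_w.
  apply: leq_trans (rank_leq_row (hom_mx v)); apply: mxrankS.
  apply/row_subP => i; rewrite rowK.
  by have := wP i; rewrite PE => /conv_rangeP[a _ <-]; apply: submxMl.
have kd : k = d by apply/eqP; rewrite eqn_leq le_kd.
subst k; exists v => //.
by rewrite -row_free_unit; apply/affinely_independentP.
Qed.

(** The matrix by which the map sending x to x A + w acts on homogeneous
    coordinates. *)
Definition affine_mx (R : nzRingType) d (A : 'M[R]_d) (w : 'rV[R]_d) :
    'M[R]_(1 + d) :=
  block_mx 1 w 0 A.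

Lemma hom_mx_affine (R : nzRingType) n d (v : 'I_n -> 'rV[R]_d)
    (A : 'M[R]_d) (w : 'rV[R]_d) :
  hom_mx (fun i => v i *m A + w) = hom_mx v *m affine_mx A w.
Proof.
apply/row_matrixP => i; rewrite row_mul !rowK mul_row_block.
by rewrite !mul1mx mulmx0 addr0 addrC.
Qed.

Lemma image_conv_range (R : realType) n d (v : 'I_n -> 'rV[R]_d)
    (A : 'M[R]_d) (w : 'rV[R]_d) :
  [set x *m A + w | x in conv (range v)] =
  conv (range (fun i => v i *m A + w)).
Proof.
apply/seteqP.
split=> [_ [x /conv_rangeP[a a_ge0 ax] <-]|y /conv_rangeP[a a_ge0 ay]].
  apply/conv_rangeP; exists a; rewrite // hom_mx_affine mulmxA ax.
  by rewrite mul_row_block !mul1mx mulmx0 addr0 addrC.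
move: ay; rewrite hom_mx_affine mulmxA mulmx_hom_mx mul_row_block.
rewrite mulmx1 mulmx0 addr0 => /eq_row_mx[a1]; rewrite a1 mul1mx => ay.
exists (\sum_i a 0 i *: v i); last by rewrite -ay addrC.
by apply/conv_rangeP; exists a => //; rewrite mulmx_hom_mx a1.
Qed.

Lemma dilateE (R : realType) d r (P : set 'rV[R]_d) :
  dilate r P = [set x *m (r%:R)%:M + 0 | x in P].
Proof.
by rewrite /dilate; apply: eq_imagel => x _; rewrite mul_mx_scalar addr0.
Qed.

(** A column of [K] is an affine function on the points with leading coordinate
    [s]: its top entry is the constant term, the others are the linear part. *)
Lemma row_mx_mul_entry (R : realType) d n (s : R) (x : 'rV[R]_d)
    (K : 'M[R]_(1 + d, n)) i :
  (row_mx s%:M x *m K) 0 i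
  = s * K (lshift d 0) i + dotp x (\row_j K (rshift 1 j) i).
Proof.
rewrite mxE big_split_ord big_ord1 /= row_mxEl mxE eqxx mulr1n; congr (_ + _).
by apply: eq_bigr => j _; rewrite row_mxEr mxE.
Qed.

Lemma dotpC (R : realType) d (x y : 'rV[R]_d) : dotp x y = dotp y x.
Proof. by apply: eq_bigr => j _; rewrite mulrC. Qed.

Lemma dotp_suml (R : realType) d n (a : 'I_n -> R) (u : 'I_n -> 'rV[R]_d) y :
  dotp (\sum_i a i *: u i) y = \sum_i a i * dotp (u i) y.
Proof.
rewrite /dotp (eq_bigr (fun j => \sum_i a i * (u i 0 j * y 0 j))).
  by rewrite exchange_big; apply: eq_bigr => i _; rewrite mulr_sumr.
move=> j _; rewrite summxE mulr_suml; apply: eq_bigr => i _.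
by rewrite mxE mulrA.
Qed.

(** The i-th barycentric coordinate is at most 1 on the simplex, and equals 1
    at the i-th vertex only, so that its linear part exposes this vertex. *)
Lemma simplex_vertex (R : realType) d (v : 'I_(1 + d) -> 'rV[R]_d) i :
  hom_mx v \in unitmx -> vertex (conv (range v)) (v i).
Proof.
move=> v_unit; split; first by apply: sub_conv; exists i.
set K := invmx (hom_mx v); pose c := \row_j K (rshift 1 j) i; exists c.
have dotpE x : dotp c x = (row_mx 1 x *m K) 0 i - K (lshift d 0) i.
  by rewrite row_mx_mul_entry mul1r [X in X - _]addrC addrK; exact: dotpC.
have barV k : row_mx 1 (v k) *m K = row k 1%:M.
  by rewrite -[row_mx _ _](rowK (fun k => row_mx 1 (v k))) -row_mul mulmxV.
move=> x /conv_rangeP[a a_ge0 ax] neq_xv; rewrite !dotpE ltrD2r barV.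
rewrite [X in _ < X]mxE [X in _ < X]mxE eqxx -ax mulmxK //.
have [a1 ax'] := hom_mx_combination ax.
have a_rest : \sum_(k | k != i) a 0 k = 1 - a 0 i.
  by rewrite -a1 [X in _ = X - _](bigD1 i) //= [X in _ = X - _]addrC addrK.
rewrite lt_neqAle -subr_ge0 -a_rest sumr_ge0 ?andbT //.
apply/eqP => ai1; apply: neq_xv.
rewrite -ax' (bigD1 i) //= ai1 scale1r big1 ?addr0 //.
move=> k ki; have /psumr_eq0P-> // : \sum_(k | k != i) a 0 k = 0.
  by rewrite a_rest ai1 subrr.
by rewrite scale0r.
Qed.

(** If the i-th barycentric coordinate vanished at [x], it would become negative
    as soon as [x] moved away from the i-th vertex. *)
Lemma interior_bary_gt0 (R : realType) d (v : 'I_(1 + d) -> 'rV[R]_d) x i :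
  hom_mx v \in unitmx -> interior (conv (range v)) x ->
  0 < (row_mx 1 x *m invmx (hom_mx v)) 0 i.
Proof.
move=> v_unit x_int; set K := invmx _.
have bar_ge0 y : conv (range v) y -> 0 <= (row_mx 1 y *m K) 0 i.
  by case/conv_rangeP => a a_ge0 <-; rewrite mulmxK.
have barV : (row_mx 1 (v i) *m K) 0 i = 1.
  rewrite -[row_mx _ _](rowK (fun k => row_mx 1 (v k))) -row_mul mulmxV //.
  by rewrite !mxE eqxx.
rewrite lt_neqAle bar_ge0 ?andbT; last exact: interior_subset x_int.
apply/eqP => bar0.
have cont : x + t *: (x - v i) @[t --> (0 : R)] --> x + 0 *: (x - v i).
  by apply: cvgD; [exact: cvg_cst | apply: cvgZr_tmp; exact: cvg_id].
rewrite scale0r addr0 in cont.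
have /nbhs_ballP[e /= e_gt0 ball_e] := cont _ x_int.
have e2_gt0 : 0 < e / 2 by rewrite divr_gt0.
have /ball_e/= : ball 0 e (e / 2).
  rewrite -ball_normE /= sub0r normrN gtr0_norm // gtr_pMr //.
  by rewrite invf_lt1 ?ltr1n.
move/bar_ge0.
have -> : row_mx 1 (x + (e / 2) *: (x - v i)) =
    row_mx 1 x + (e / 2) *: (row_mx 1 x - row_mx 1 (v i)).
  by rewrite opp_row_mx add_row_mx subrr scale_row_mx scaler0 add_row_mx addr0.
have entryD (y z : 'rV[R]_(1 + d)) t :
  (y + t *: (y - z)) 0 i = y 0 i + t * (y 0 i - z 0 i) by rewrite !mxE.
rewrite mulmxDl -scalemxAl mulmxBl entryD barV -bar0 !sub0r add0r mulrN1.
by rewrite oppr_ge0 leNgt e2_gt0.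
Qed.

Lemma unitmx_affine (R : comUnitRingType) d (A : 'M[R]_d) w :
  A \in unitmx -> affine_mx A w \in unitmx.
Proof. by rewrite !unitmxE det_ublock det1 mul1r. Qed.

Lemma interior_dilate_bary_gt0 (R : realType) d (v : 'I_(1 + d) -> 'rV[R]_d)
    (r : nat) x i :
  hom_mx v \in unitmx -> (0 < r)%N -> interior (dilate r (conv (range v))) x ->
  0 < (row_mx r%:R%:M x *m invmx (hom_mx v)) 0 i.
Proof.
move=> v_unit r_gt0; pose A : 'M[R]_d := r%:R%:M.
rewrite dilateE image_conv_range -/A; set v' := fun i => _.
have r_gt0' : 0 < r%:R :> R by rewrite ltr0n.
have A_unit : A \in unitmx.
  by rewrite unitmxE det_scalar unitrX // unitfE gt_eqF.
have v'E : hom_mx v' = hom_mx v *m affine_mx A 0 by rewrite hom_mx_affine.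
have v'_unit : hom_mx v' \in unitmx.
  by rewrite v'E unitmx_mul v_unit unitmx_affine.
move/(interior_bary_gt0 i v'_unit); set a := _ *m _ => a_gt0.
have : a *m hom_mx v' = row_mx 1 x by rewrite mulmxKV.
rewrite v'E mulmxA mulmx_hom_mx mul_row_block mulmx1 mulmx0 addr0 mulmx0 add0r.
rewrite mul_mx_scalar => /eq_row_mx[a1 ax].
have -> : row_mx r%:R%:M x = r%:R *: (a *m hom_mx v).
  by rewrite mulmx_hom_mx scale_row_mx ax a1 scalemx1.
by rewrite -scalemxAl mulmxK // mxE mulr_gt0.
Qed.

(** * Weights of a Gorenstein simplex *)

(** The pairing of [u] with each [q k] except [q i] is 1.  Hence [u] maximizes
    the pairing with the sum of these [q k] over the polar polytope.  Any
    maximizer pairs with them to 1 as well, and then its pairing with [q i] is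
    fixed, because the origin is a combination of the [q k] with positive
    coefficients. *)
Lemma polar_vertex (R : realType) d (q : 'I_(1 + d) -> 'rV[R]_d) i
    (K := invmx (hom_mx q)) :
  hom_mx q \in unitmx -> (forall k, 0 < K (lshift d 0) k) ->
  vertex (polar (conv (range q)))
    (- (K (lshift d 0) i)^-1 *: \row_j K (rshift 1 j) i).
Proof.
move=> q_unit K0_gt0; set u := - _ *: _.
have dotp_q k y : dotp (q k) y = (row_mx (0 : 'M_1) (q k) *m col_mx 0 y^T) 0 0.
  rewrite mul_row_col mul0mx add0r mxE.
  by apply: eq_bigr => j _; rewrite mxE.
have dotp_qu k : dotp (q k) u = 1 - (k == i)%:R / K (lshift d 0) i.
  have : (row_mx 1%:M (q k) *m K) 0 i = (k == i)%:R.
    rewrite -[row_mx _ _](rowK (fun k => row_mx 1 (q k))) -row_mul mulmxV //.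
    by rewrite !mxE.
  rewrite row_mx_mul_entry mul1r => /(canRL (addKr _)) dotpK.
  have -> : dotp (q k) u = - (K (lshift d 0) i)^-1 *
      dotp (q k) (\row_j K (rshift 1 j) i).
    rewrite /dotp mulr_sumr; apply: eq_bigr => j _.
    by rewrite /u [X in _ * X = _]mxE mulrCA.
  by rewrite dotpK mulrDr mulrNN mulVf ?lt0r_neq0 // mulNr mulrC.
have bary0 : \sum_k K (lshift d 0) k *: q k = 0.
  have : row_mx 1 0 *m K *m hom_mx q = row_mx 1%:M 0 by rewrite mulmxKV.
  case/hom_mx_combination => _ sum0; rewrite -[RHS]sum0; apply: eq_bigr => k _.
  rewrite row_mx_mul_entry mul1r [dotp _ _]big1 ?addr0 // => j _.
  by rewrite [X in X * _]mxE mul0r.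
have polarE y : polar (conv (range q)) y <-> forall k, dotp (q k) y <= 1.
  split=> [y_polar k|y_le _ [m [a [z [a_ge0 a_sum zq ->]]]]].
    by apply: y_polar; apply: sub_conv; exists k.
  rewrite dotp_suml -a_sum ler_sum // => l _.
  by case: (zq l) => k _ <-; rewrite ler_piMr.
split; first by apply/polarE => k; rewrite dotp_qu gerBl divr_ge0 // ltW.
exists (\sum_(k | k != i) q k) => y /polarE y_le neq_yu.
have dotp_c z : dotp (\sum_(k | k != i) q k) z = \sum_(k | k != i) dotp (q k) z.
  rewrite -[LHS](_ : dotp (\sum_k (k != i)%:R *: q k) z = _).
    rewrite dotp_suml [RHS]big_mkcond; apply: eq_bigr => k _.
    by case: (k != i); rewrite ?mul1r ?mul0r.
  congr dotp; rewrite [RHS]big_mkcond; apply: eq_bigr => k _.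
  by case: (k != i); rewrite ?scale1r ?scale0r.
rewrite ltNge; apply/negP => u_le_y; apply: neq_yu.
have dotp_qy k : k != i -> dotp (q k) y = dotp (q k) u.
  move=> ki; have qu1 l : l != i -> dotp (q l) u = 1.
    by move=> /negPf li; rewrite dotp_qu li mul0r subr0.
  apply/eqP; rewrite eq_sym -subr_eq0; apply/eqP; move: k ki.
  apply: psumr_eq0P => [l li|]; first by rewrite subr_ge0 qu1.
  apply/eqP; rewrite sumrB subr_eq0 -!dotp_c eq_le u_le_y /=.
  by rewrite !dotp_c ler_sum // => l li; rewrite qu1.
(* A linear functional on the relation [bary0] expresses the value at [q i]. *)
have dotp_qiy : dotp (q i) y = dotp (q i) u.
  have sum0 z : K (lshift d 0) i * dotp (q i) z =
      - \sum_(k | k != i) K (lshift d 0) k * dotp (q k) z.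
    apply/eqP; rewrite -addr_eq0 -(bigD1 i (P := predT)) //= -dotp_suml bary0.
    by rewrite [dotp _ _]big1 // => j _; rewrite mxE mul0r.
  apply: (mulfI (lt0r_neq0 (K0_gt0 i))); rewrite !sum0; congr (- _).
  by apply: eq_bigr => k /dotp_qy->.
have : hom_mx q *m col_mx 0 y^T = hom_mx q *m col_mx 0 u^T :> 'cV_(1 + d).
  apply/matrixP => k l; rewrite (ord1 l).
  have entryE z : (hom_mx q *m col_mx 0 z^T) k 0 = dotp (q k) z.
    have -> : (hom_mx q *m col_mx 0 z^T) k 0 =
        row k (hom_mx q *m col_mx 0 z^T) 0 0 by rewrite [RHS]mxE.
    by rewrite row_mul rowK dotp_q !mul_row_col !mulmx0.
  by rewrite !entryE; have [->|/dotp_qy->] := eqVneq k i; rewrite ?dotp_qiy.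
move/(congr1 (mulmx K)); rewrite !mulKmx // => /eq_col_mx[_].
exact: trmx_inj.
Qed.

Lemma continuous_affine (R : realType) d (A : 'M[R]_d) (w : 'rV[R]_d) :
  continuous (fun x : 'rV[R]_d => x *m A + w).
Proof.
move=> x; rewrite /continuous_at.
have coord j : (fun y : 'rV[R]_d => y 0 j) @ nbhs x --> x 0 j.
  exact: coord_continuous.
have FF : Filter (nbhs x) by exact: nbhs_filter.
move: (nbhs x) FF coord => F FF coord.
apply: cvgD; last exact: cvg_cst.
rewrite mulmx_sum_row; under eq_fun do rewrite mulmx_sum_row.
elim: (index_enum _) => [|j s IHs].
  by rewrite big_nil; under eq_fun do rewrite big_nil; apply: cvg_cst.
rewrite big_cons.
have -> : (fun y : 'rV[R]_d => \sum_(k <- j :: s) y 0 k *: row k A) =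
    (fun y => y 0 j *: row j A) \+ (fun y => \sum_(k <- s) y 0 k *: row k A).
  by apply/funext => y; rewrite big_cons.
by apply: cvgD IHs; apply: cvgZr_tmp; apply: coord.
Qed.

Lemma unitmx_unimodular (n : nat) (U : 'M[int]_n) :
  \det U = 1 \/ \det U = -1 -> U \in unitmx.
Proof. by rewrite unitmxE => -[] ->. Qed.

(** Let [q] be the vertices of the reflexive polytope and [Kq] the inverse of
    their homogeneous matrix; [p] is the point that is mapped to the origin.
    The vertices of the polar polytope are integral, and the i-th of them is
    the linear part of the i-th barycentric coordinate divided by minus its
    constant term.  Pulled back to [v], this makes the lower entries of the
    i-th column of [K] integral multiples of the weight [b i].  The top entry
    is then one as well, since the i-th barycentric coordinate vanishes at any
    other vertex, which is a lattice point. *)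
Lemma gorenstein_weights (R : realType) d (v : 'I_(1 + d) -> 'rV[R]_d) r Q
    (D := conv (range v)) (K := invmx (hom_mx v)) :
    (0 < d)%N -> hom_mx v \in unitmx -> (forall k, lattice_point (v k)) ->
    (0 < r)%N -> reflexive_polytope Q -> unimod_equiv (dilate r D) Q ->
  exists p : 'rV[R]_d,
    [/\ lattice_point p, interior (dilate r D) p
      & forall k i, K k i / (row_mx r%:R%:M p *m K) 0 i \is a Num.int].
Proof.
move=> d_gt0 v_unit v_int r_gt0 [_ _ Q0 [_ polarQ_int]] [U [w [detU QE]]].
have U_unit := unitmx_unimodular detU.
pose A : 'M[R]_d := map_mx intr U; pose w' : 'rV[R]_d := map_mx intr w.
pose Ai : 'M[R]_d := map_mx intr (invmx U).
have AAi : A *m Ai = 1%:M by rewrite -map_mxM mulmxV // map_mx1.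
have AiA : Ai *m A = 1%:M by rewrite -map_mxM mulVmx // map_mx1.
rewrite -/A -/w' in QE.
pose p := - (w' *m Ai).
have pA : p *m A + w' = 0 by rewrite mulNmx -mulmxA AiA mulmx1 addNr.
have p_int : lattice_point p.
  move=> j; have -> : p = map_mx intr (- (w *m invmx U)).
    by rewrite map_mxN map_mxM.
  by rewrite mxE intr_int.
have p_interior : interior (dilate r D) p.
  have nbhs_p : nbhs p ((fun x => x *m A + w') @^-1` Q).
    by apply: (@continuous_affine _ _ A w' p); rewrite pA.
  rewrite /interior /=; apply: filterS nbhs_p => x /=; rewrite QE.
  case=> y yD /addIr /(congr1 (mulmx^~ Ai)).
  by rewrite -!mulmxA AAi !mulmx1 => <-.
exists p; split=> //.
pose T : 'M[R]_(1 + d) := affine_mx r%:R%:M 0 *m affine_mx A w'.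
have QE' : Q = conv (range (fun i => (v i *m r%:R%:M + 0) *m A + w')).
  by rewrite QE dilateE !image_conv_range.
set q := fun i => _ in QE'.
have qE : hom_mx q = hom_mx v *m T by rewrite !hom_mx_affine mulmxA.
have r_neq0 : r%:R != 0 :> R by rewrite pnatr_eq0 -lt0n.
have q_unit : hom_mx q \in unitmx.
  rewrite qE unitmx_mul v_unit unitmx_mul !unitmx_affine //.
    by case: (mulmx1_unit AAi).
  by rewrite unitmxE det_scalar unitrX // unitfE.
pose Kq := invmx (hom_mx q).
have KE : K = T *m Kq.
  have /(congr1 (mulmx K)) := mulmxV q_unit.
  by rewrite mulmx1 {1}qE -/Kq -mulmxA mulKmx.
have Kq0_gt0 k : 0 < Kq (lshift d 0) k.
  have := interior_bary_gt0 k q_unit; rewrite -QE' => /(_ _ Q0).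
  rewrite row_mx_mul_entry mul1r [dotp _ _]big1 ?addr0 // => j _.
  by rewrite [X in X * _]mxE mul0r.
have weightE i : (row_mx r%:R%:M p *m K) 0 i = r%:R * Kq (lshift d 0) i.
  rewrite KE mulmxA.
  have -> : row_mx r%:R%:M p *m T = row_mx r%:R%:M 0.
    rewrite mulmxA !mul_row_block !mulmx1 !mulmx0 !addr0 add0r.
    rewrite mul_mx_scalar mul_scalar_mx -scalemxAl -scalerDr.
    by rewrite [w' + _]addrC pA scaler0.
  rewrite row_mx_mul_entry [dotp _ _]big1 ?addr0 // => j _.
  by rewrite [X in X * _]mxE mul0r.
have lower_int j i :
    K (rshift 1 j) i / (r%:R * Kq (lshift d 0) i) \is a Num.int.
  have u_int : lattice_point
      (- (Kq (lshift d 0) i)^-1 *: \row_j Kq (rshift 1 j) i).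
    by apply: polarQ_int; rewrite QE'; apply: polar_vertex.
  set u := _ *: _ in u_int.
  suff -> : K (rshift 1 j) i / (r%:R * Kq (lshift d 0) i) =
      - \sum_l (U j l)%:~R * u 0 l.
    by rewrite rpredN rpred_sum // => l _; rewrite rpredM // intr_int.
  have -> : K (rshift 1 j) i = r%:R * \sum_l A j l * Kq (rshift 1 l) i.
    have TE : T = block_mx 1 w' 0 (r%:R *: A).
      rewrite /T mulmx_block !mulmx0 !mul0mx !mulmx1 !mul1mx !addr0 !add0r.
      by rewrite mul_scalar_mx.
    rewrite KE TE mxE big_split_ord big_ord1 /= block_mxEdl mxE mul0r add0r.
    by rewrite mulr_sumr; apply: eq_bigr => l _; rewrite block_mxEdr mxE mulrA.
  rewrite -mulf_div divff // mul1r mulr_suml -sumrN; apply: eq_bigr => l _.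
  by rewrite /u !mxE mulNr mulrN opprK mulrAC mulrA.
move=> k i; rewrite weightE; case: (split_ordP k) => [z|j] -> //.
rewrite (ord1 z) => {k z}.
(* Any vertex other than the i-th one will do. *)
pose k := if i == lshift d 0 then rshift 1 (Ordinal d_gt0) else lshift d 0.
have ki : (k == i) = false.
  by rewrite /k; have [->|/negPf] := eqVneq i; rewrite ?eq_rlshift // eq_sym.
have : (row_mx 1%:M (v k) *m K) 0 i = 0.
  rewrite -[row_mx _ _](rowK (fun k => row_mx 1 (v k))) -row_mul mulmxV //.
  by rewrite !mxE ki.
rewrite row_mx_mul_entry mul1r => /(canRL (addrK _)) ->.
rewrite sub0r mulNr rpredN /dotp mulr_suml rpred_sum // => j _.
by rewrite mxE -mulrA rpredM //; apply: v_int.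
Qed.
Lemma int_gt0_ge1 (R : realType) (x : R) : x \is a Num.int -> 0 < x -> 1 <= x.
Proof. by move=> /intrP[m ->]; rewrite ltr0z ler1z. Qed.

Lemma codegP (R : realType) d (P : set 'rV[R]_d) : (0 < codeg P)%N ->
  interior_lattice_point P (codeg P) /\
  forall m, (0 < m)%N -> interior_lattice_point P m -> (codeg P <= m)%N.
Proof. by rewrite /codeg; case: xgetP => // n _ [_ ? ?]. Qed.

(** The weights of [gorenstein_weights] add up to [r], so it is enough to see
    that [r] is the codegree.  The point [p] gives one inequality.  For the
    other, the i-th coordinate of an interior lattice point of a dilate of [D]
    is a positive multiple of [b i], hence at least [b i]. *)
Lemma gorenstein_codeg_weights (R : realType) d (v : 'I_(1 + d) -> 'rV[R]_d)
    (D := conv (range v)) (K := invmx (hom_mx v)) :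
    (0 < d)%N -> hom_mx v \in unitmx -> (forall k, lattice_point (v k)) ->
    gorenstein D -> (0 < codeg D)%N ->
  exists2 p : 'rV[R]_d, lattice_point p &
    let b i := (row_mx (codeg D)%:R%:M p *m K) 0 i in
    [/\ forall i, 0 < b i, \sum_i b i = (codeg D)%:R,
        forall k i, K k i / b i \is a Num.int
      & forall i, (b i)^-1 \is a Num.int].
Proof.
move=> d_gt0 v_unit v_int [_ _ [r [Q [r_gt0 Q_reflexive rDQ]]]] c_gt0.
have [p [p_int p_interior]] :=
  gorenstein_weights d_gt0 v_unit v_int r_gt0 Q_reflexive rDQ.
rewrite -/D -/K in p_interior *; set b := _ *m _ => Kb_int.
have b_gt0 i : 0 < b 0 i by apply: interior_dilate_bary_gt0.
have sum_bary s (x : 'rV_d) : \sum_i (row_mx s%:M x *m K) 0 i = s.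
  have xE : row_mx s%:M x *m K *m hom_mx v = row_mx s%:M x by rewrite mulmxKV.
  by have [] := hom_mx_combination xE.
have [[x x_interior x_int] c_min] := codegP c_gt0.
suff cr : codeg D = r.
  exists p => //; rewrite cr -/b; split=> //; first exact: sum_bary.
  move=> i.
  have : (hom_mx v *m K) i i = 1 by rewrite mulmxV // mxE eqxx.
  rewrite mxE => /(congr1 (fun y => y / b 0 i)); rewrite mul1r => <-.
  rewrite mulr_suml rpred_sum // => k _; rewrite -mulrA rpredM // mxE.
  case: (split_ordP k) => j ->; last by rewrite row_mxEr; apply: v_int.
  by rewrite row_mxEl mxE rpred_nat.
apply/eqP; rewrite eqn_leq; apply/andP; split.
  by apply: c_min => //; exists p.
rewrite -(ler_nat R) -[X in X <= _](sum_bary _ p) -[X in _ <= X](sum_bary _ x).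
apply: ler_sum => i _; rewrite -/b -[X in X <= _]mul1r -ler_pdivlMr //.
apply: int_gt0_ge1; last first.
  by rewrite divr_gt0 //; apply: interior_dilate_bary_gt0.
rewrite row_mx_mul_entry mulrDl rpredD //.
  by rewrite -mulrA rpredM ?rpred_nat //; apply: Kb_int.
rewrite /dotp mulr_suml rpred_sum // => j _.
by rewrite mxE -mulrA rpredM //; apply: x_int.
Qed.

(** Each reciprocal is an integer larger than 1, so no [b i] exceeds 1/2, while
    their mean is 1/2. *)
Lemma half_weights (R : realType) (b : 'I_8 -> R) :
  (forall i, 0 < b i) -> (forall i, (b i)^-1 \is a Num.int) ->
  (forall i, b i != 1) -> \sum_i b i = 4 -> forall i, b i = 2^-1.
Proof.
move=> b_gt0 b_int b_neq1 b_sum.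
have b_le i : b i <= 2^-1.
  have bV_gt0 : 0 < (b i)^-1 by rewrite invr_gt0.
  have bV_neq1 : (b i)^-1 != 1 by rewrite invr_eq1.
  rewrite -[b i]invrK lef_pV2 ?posrE ?ltr0n //.
  move: bV_gt0 bV_neq1; have /intrP[z ->] := b_int i.
  rewrite ltr0z -[1]/(1%:~R) -[2%:R]/(2%:~R) eqr_int ler_int.
  by case: z => [[|[]]|].
move=> i; apply/eqP; rewrite eq_sym -subr_eq0; apply/eqP; move: i (isT : true).
apply: psumr_eq0P => [i _|]; first by rewrite subr_ge0.
rewrite sumrB b_sum sumr_const card_ord -[_ *+ 8]mulr_natr.
have -> : 8%:R = 2 * 4 :> R by rewrite -natrM.
by rewrite mulKf ?subrr // pnatr_eq0.
Qed.

(** * Lattice pyramids *)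

Lemma int_mxP (R : realType) m n (A : 'M[R]_(m, n)) :
  (forall i j, A i j \is a Num.int) ->
  exists B : 'M[int]_(m, n), A = map_mx intr B.
Proof.
move=> A_int; exists (map_mx Num.floor A).
by apply/matrixP => i j; rewrite !mxE floorK.
Qed.

Lemma unimodularP (n : nat) (U : 'M[int]_n) :
  U \in unitmx -> \det U = 1 \/ \det U = -1.
Proof.
rewrite unitmxE => /orP[] /eqP ->; [by left | by right].
Qed.

(** The Smith normal form of a column has at most one nonzero entry, and the
    relation [g *m l = 1] forces this entry to be a unit. *)
Lemma unimodular_completion n (l : 'cV[int]_n) (g : 'rV[int]_n) (k : 'I_n) :
  g *m l = 1 -> exists2 L : 'M[int]_n, L \in unitmx & L *m l = delta_mx k 0.
Proof.
move=> gl; have [L0 L0_unit [R0 _ [s _ lE]]] := int_Smith_normal_form l.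
pose k0 : 'I_n := Ordinal (leq_ltn_trans (leq0n k) (ltn_ord k)).
pose e := s`_0 * R0 0 0.
have L0l : invmx L0 *m l = e *: delta_mx k0 0.
  rewrite lE -mulmxA mulKmx //; apply/matrixP => i j; rewrite (ord1 j) {j}.
  rewrite !mxE big_ord1 !mxE eqxx andbT.
  rewrite -val_eqE /=.
  by case: eqP => [->|]; rewrite ?mulr0n ?mul0r ?mulr0 ?mulr1.
have e_unit : e \is a GRing.unit.
  have: g *m L0 *m (invmx L0 *m l) = 1 by rewrite mulmxA mulmxK.
  rewrite L0l -scalemxAr => /matrixP/(_ 0 0); rewrite !mxE => ex.
  by apply/unitrPr; eexists; apply: ex.
exists (e^-1 *: xrow k0 k (invmx L0)).
  rewrite unitmxZ ?unitrV // /xrow row_permE unitmx_mul unitmx_perm.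
  by rewrite unitmx_inv.
rewrite -scalemxAl /xrow row_permE -mulmxA L0l -scalemxAr scalerA mulVr //.
rewrite scale1r -row_permE; apply/matrixP => i j; rewrite !mxE.
by rewrite (can2_eq (tpermK k0 k) (tpermK k0 k)) tpermL.
Qed.

Lemma affinely_independent_lift (R : realType) n d (v : 'I_n -> 'rV[R]_d) i :
  affinely_independent v -> affinely_independent (fun k => v (lift i k)).
Proof.
move=> v_ind a a0 av0 k.
(* The coefficients [a], completed by 0 at [i]. *)
pose b j := if unlift i j is Some k then a k else 0.
have bi : b i = 0 by rewrite /b unlift_none.
have b_lift j : b (lift i j) = a j by rewrite /b liftK.
rewrite -b_lift; apply: v_ind; rewrite (bigD1_ord i) //= bi ?scale0r add0r.
  by rewrite -[RHS]a0; apply: eq_bigr => j _; rewrite b_lift.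
by rewrite -[RHS]av0; apply: eq_bigr => j _; rewrite b_lift.
Qed.

(** The i-th barycentric coordinate is an integral affine function that is 1 at
    [v i] and 0 at the other vertices, one of which is [v j0].  A unimodular
    change of coordinates, with [v j0] as the new origin, turns it into the last
    coordinate; a shear given by [B] then moves the apex to the last unit
    vector. *)
Lemma lattice_pyramid_of_apex (R : realType) d
    (v : 'I_(1 + (d + 1)) -> 'rV[R]_(d + 1)) i (K := invmx (hom_mx v)) :
    hom_mx v \in unitmx -> (forall k, lattice_point (v k)) ->
    (forall k, K k i \is a Num.int) ->
  lattice_pyramid (conv (range v)).
Proof.
move=> v_unit v_int Ki_int; split; first exact: lattice_polytope_conv_range.
have /choice[z zE] k : exists zk : 'rV[int]_(d + 1), v k = map_mx intr zk.
  by apply: int_mxP => a b; rewrite (ord1 a); apply: v_int.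
have [lT lE] : exists lT : 'rV[int]_(d + 1),
    \row_j K (rshift 1 j) i = map_mx intr lT.
  by apply: int_mxP => a b; rewrite mxE.
pose l := lT^T.
pose j0 := lift i (rshift d 0).
(* [l] is the linear part of the i-th barycentric coordinate. *)
have zl k : (z k - z j0) *m l = ((k == i)%:R)%:M.
  have barE j : (row_mx 1%:M (v j) *m K) 0 i = (j == i)%:R.
    rewrite -[row_mx _ _](rowK (fun k => row_mx 1 (v k))) -row_mul mulmxV //.
    by rewrite !mxE.
  have dotpE j : ((z j *m l) 0 0)%:~R = (j == i)%:R - K (lshift (d + 1) 0) i.
    rewrite -barE row_mx_mul_entry mul1r lE [X in X - _]addrC addrK zE.
    rewrite mxE rmorph_sum; apply: eq_bigr => a _.
    by rewrite rmorphM !mxE.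
  apply/matrixP => a b; rewrite (ord1 a) (ord1 b) [RHS]mxE mulr1n.
  apply: (@intr_inj R).
  have entryB (p q : 'M[int]_1) : (p - q) 0 0 = p 0 0 - q 0 0.
    by rewrite !mxE.
  rewrite mulmxBl entryB rmorphB /= !dotpE.
  have -> : (j0 == i) = false by rewrite eq_sym (negPf (neq_lift _ _)).
  by rewrite sub0r opprK subrK; case: (k == i).
have [L L_unit Ll] : exists2 L : 'M[int]_(d + 1), L \in unitmx &
    L *m l = delta_mx (rshift d 0) 0.
  apply: (unimodular_completion (g := z i - z j0)).
  by rewrite zl eqxx.
pose t k := (z k - z j0) *m invmx L.
(* Off the apex the last coordinate of [t k] is 0, at the apex it is 1. *)
have tE k : t k = row_mx (lsubmx (t k)) ((k == i)%:R)%:M.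
  rewrite -[LHS]hsubmxK; congr row_mx.
  rewrite -zl -[in RHS](mulmxKV L_unit (z k - z j0)).
  rewrite -/(t k) -mulmxA Ll -[in RHS](hsubmxK (t k)).
  have -> : delta_mx (rshift d 0) 0 = col_mx 0 1 :> 'cV[int]_(d + 1).
    apply/matrixP => a b; rewrite (ord1 b) !mxE eqxx andbT.
    by case: (split_ordP a) => c ->; rewrite mxE ?eq_lrshift // (ord1 c) eqxx.
  by rewrite mul_row_col mulmx0 mulmx1 add0r.
pose B : 'M[int]_(d + 1) := block_mx 1%:M 0 (lsubmx (t i)) 1%:M.
pose U := B *m L; pose w := z j0.
have U_unit : U \in unitmx.
  by rewrite unitmx_mul L_unit andbT unitmxE det_lblock !det1 mulr1.
pose y k : 'rV[R]_d := map_mx intr (lsubmx (t k)).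
pose x k : 'rV[R]_(d + 1) := if k == i then row_mx 0 1 else row_mx (y k) 0.
have xE k : v k = x k *m map_mx intr U + map_mx intr w.
  pose xz : 'rV[int]_(d + 1) :=
    if k == i then row_mx 0 1 else row_mx (lsubmx (t k)) 0.
  have -> : x k = map_mx intr xz.
    rewrite /x /xz; case: ifP => _; rewrite map_row_mx ?map_mx0 //.
    by rewrite map_mx1.
  rewrite -map_mxM -map_mxD zE; congr map_mx; apply/eqP.
  rewrite -subr_eq -(mulmxKV L_unit (z k - z j0)) -/(t k) mulmxA; apply/eqP.
  congr (_ *m _); rewrite tE /xz /B; case: eqP => [->|_].
    by rewrite mul_row_block !mul0mx !mul1mx !add0r.
  by rewrite mul_row_block !mulmx0 !mul0mx !mulmx1 !addr0 raddf0.
pose Q := conv (range (fun k => y (lift i k))).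
have x_lift k : x (lift i k) = row_mx (y (lift i k)) 0.
  by rewrite /x eq_sym (negPf (neq_lift _ _)).
have PyrE : Pyr Q = conv (range x).
  apply/seteqP; split.
    apply: conv_sub_range => _ [[_ [m [a [u [a_ge0 a_sum uy ->]]]] <-]|->].
      exists m, a, (fun k => row_mx (u k) 0); split=> // [k|].
        by have [j _ <-] := uy k; exists (lift i j).
      elim/big_rec2: _ => [|k p q _ <-]; first by rewrite row_mx0.
      by rewrite scale_row_mx scaler0 add_row_mx addr0.
    by apply: sub_conv; exists i; rewrite // /x eqxx.
  apply: conv_mono => _ [k _ <-]; have [k' ->|->] := unliftP i k.
    left; exists (y (lift i k')); last by rewrite x_lift.
    by apply: sub_conv; exists k'.
  by right; rewrite /x eqxx.
exists d, Q, (Pyr Q); split.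
- apply: lattice_polytope_conv_range => k j.
  by rewrite mxE intr_int.
- apply: has_dim_conv_range; first by rewrite addn1.
  have v_ind := affinely_independent_lift (i := i)
    (iffRL (affinely_independentP v) (etrans (row_free_unit _) v_unit)).
  move=> a a0 ay0; apply: v_ind; first exact: a0.
  rewrite (eq_bigr (fun k => a k *: (row_mx (y (lift i k)) 0 *m map_mx intr U)
      + a k *: map_mx intr w)) => [|k _]; last by rewrite xE x_lift scalerDr.
  rewrite big_split /= -scaler_suml a0 scale0r addr0.
  rewrite (eq_bigr (fun k => (row_mx (a k *: y (lift i k)) 0 *m map_mx intr U)))
    => [|k _]; last by rewrite scalemxAl scale_row_mx scaler0.
  rewrite -mulmx_suml.
  rewrite [X in X *m _](_ : _ = row_mx (\sum_k a k *: y (lift i k)) 0).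
    by rewrite ay0 row_mx0 mul0mx.
  by elim/big_rec2: _ => [|k p q _ ->]; rewrite ?row_mx0 // add_row_mx addr0.
- exact: iterated_Pyr1.
exists U, w; split; first exact: (unimodularP U_unit).
by rewrite PyrE image_conv_range -(funext xE).
Qed.

(** * Even binary codes of length 8 *)

Fixpoint bits_add (u v : seq bool) : seq bool :=
  match u, v with
  | a :: u', b :: v' => a (+) b :: bits_add u' v'
  | [::], _ => v
  | _, [::] => u
  end.

Fixpoint bits_lt (u v : seq bool) : bool :=
  match u, v with
  | a :: u', b :: v' => if a == b then bits_lt u' v' else b
  | _, _ => false
  end.

Definition pivot_bit (u v : seq bool) : bool := nth false v (index true u).

Definition reduce (B : seq (seq bool)) (u : seq bool) : seq bool :=
  foldl (fun v b => if pivot_bit b v then bits_add v b else v) u B.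

(** The lists [B] of interest are reduced echelon forms, kept in increasing
    lexicographic order; then a code has only one such list. *)
Definition add_generator (B : seq (seq bool)) (u : seq bool) : seq (seq bool) :=
  let w := reduce B u in
  if true \in w then
    sort (fun a b => ~~ bits_lt b a)
      (w :: [seq if pivot_bit w b then bits_add b w else b | b <- B])
  else B.

Definition echelon (G : seq (seq bool)) : seq (seq bool) :=
  foldl add_generator [::] G.

Definition permute (p : seq nat) (u : seq bool) : seq bool :=
  [seq nth false u k | k <- p].

Definition adjacent_swaps n : seq (seq nat) :=
  [seq [seq (if k == i then i.+1 else if k == i.+1 then i else k)
       | k <- iota 0 n] | i <- iota 0 n.-1].

(** Greedy search: a move is made whenever it makes the echelon form
    lexicographically larger. *)
Fixpoint descend (moves : seq (seq nat)) (fuel : nat) (G : seq (seq bool)) :=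
  if fuel is fuel'.+1 then
    if [seq H <- [seq echelon [seq permute p u | u <- G] | p <- moves]
       | bits_lt (flatten G) (flatten H)] is H :: _
    then descend moves fuel' H else G
  else G.

(** The bound of 50 moves bears on the success of the search only: whatever it
    returns is equivalent to its argument. *)
Definition normal_form (G : seq (seq bool)) :=
  descend (adjacent_swaps 8) 50 (echelon G).

(** For each of the nineteen simplices and each of its vertices, the unit
    vectors that have an odd coefficient in this vertex. *)
Definition supports : seq (seq (seq nat)) :=
  [:: [:: [::]; [:: 1]; [:: 2]; [:: 3]; [:: 4]; [:: 5]; [:: 6];
          [:: 1; 2; 3; 4; 5; 6]];
      [:: [::]; [:: 1]; [:: 2]; [:: 1; 2]; [:: 4]; [:: 5]; [:: 6];
          [:: 4; 5; 6]];
      [:: [::]; [:: 1]; [:: 2]; [:: 3]; [:: 4]; [:: 1; 4]; [:: 2; 4];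
          [:: 3; 4]];
      [:: [::]; [:: 1]; [:: 2]; [:: 3]; [:: 2; 3]; [:: 1; 3]; [:: 1; 2];
          [:: 1; 2; 3]];
      [:: [::]; [:: 1]; [:: 2]; [:: 3]; [:: 4]; [:: 5]; [:: 1];
          [:: 2; 3; 4; 5]];
      [:: [::]; [:: 1]; [:: 2]; [:: 3]; [:: 4]; [::]; [:: 1; 2]; [:: 3; 4]];
      [:: [::]; [:: 1]; [:: 2]; [:: 3]; [:: 4]; [:: 1]; [:: 2]; [:: 3; 4]];
      [:: [::]; [:: 1]; [:: 2]; [:: 3]; [::]; [:: 1]; [:: 1; 2]; [:: 1; 3]];
      [:: [::]; [:: 1]; [:: 2]; [:: 3]; [:: 4]; [::]; [::]; [:: 1; 2; 3; 4]];
      [:: [::]; [:: 1]; [:: 1]; [:: 3]; [:: 3]; [:: 5]; [:: 5]; [::]];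
      [:: [::]; [:: 1]; [:: 2]; [::]; [:: 2]; [:: 1]; [:: 1; 2]; [:: 1; 2]];
      [:: [::]; [:: 1]; [:: 2]; [:: 3]; [::]; [::]; [:: 1]; [:: 2; 3]];
      [:: [::]; [:: 1]; [:: 2]; [::]; [::]; [:: 1]; [:: 1]; [:: 1; 2]];
      [:: [::]; [:: 1]; [:: 2]; [:: 3]; [::]; [::]; [::]; [:: 1; 2; 3]];
      [:: [::]; [:: 1]; [:: 2]; [::]; [::]; [::]; [:: 1]; [:: 2]];
      [:: [::]; [:: 1]; [::]; [::]; [::]; [:: 1]; [:: 1]; [:: 1]];
      [:: [::]; [:: 1]; [:: 2]; [::]; [::]; [::]; [::]; [:: 1; 2]];
      [:: [::]; [:: 1]; [::]; [::]; [::]; [::]; [::]; [:: 1]];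
      [:: [::]; [::]; [::]; [::]; [::]; [::]; [::]; [::]]]%N.

(** The words are the columns of the vertex matrix modulo 2, the first one
    being the column of ones. *)
Definition support_code (m : seq (seq nat)) : seq (seq bool) :=
  nseq 8 true :: [seq [seq c \in r | r <- m] | c <- iota 1 7].

Fixpoint bit_lists n : seq (seq bool) :=
  if n is n'.+1 then [seq b :: u | b <- [:: false; true], u <- bit_lists n']
  else [:: [::]].

Definition even_bit_lists := [seq u <- bit_lists 8 | ~~ odd (count id u)].

(** This is the step of an induction on the number of generators of a code.  The
    greedy search may stop at a local maximum outside the list; it is therefore
    started from each of the eight rotations of the coordinates. *)
Definition one_step_closed (Cs : seq (seq (seq bool))) : bool :=
  (* [find] stops at the first rotation that succeeds, also when evaluation is
     by value. *)
  all (fun C => all (fun E => find (fun k =>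
        normal_form [seq permute (rot k (iota 0 8)) u | u <- E] \in Cs)
      (iota 0 8) < 8)%N
    (undup [seq add_generator C u | u <- even_bit_lists])) Cs.

Definition bitrow n (u : seq bool) : 'rV['F_2]_n := \row_i (nth false u i)%:R.

(** Codes are compared as row spaces over F_2; the bit lists only serve to
    compute. *)
Definition span_code n (G : seq (seq bool)) : 'M['F_2]_n :=
  (\sum_(u <- G) <<bitrow n u>>)%MS.

Definition code_equiv n k l (A : 'M['F_2]_(k, n)) (B : 'M['F_2]_(l, n)) :=
  exists s : 'S_n, (A *m perm_mx s :=: B)%MS.

Lemma code_equiv_refl n k (A : 'M['F_2]_(k, n)) : code_equiv A A.
Proof. by exists 1%g; rewrite perm_mx1 mulmx1. Qed.

Lemma code_equiv_sym n k l (A : 'M['F_2]_(k, n)) (B : 'M['F_2]_(l, n)) :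
  code_equiv A B -> code_equiv B A.
Proof.
case=> s sAB; exists (s^-1)%g.
apply: eqmx_trans (eqmxMr _ (eqmx_sym sAB)) _.
by rewrite -mulmxA -perm_mxM mulgV perm_mx1 mulmx1.
Qed.

Lemma code_equiv_trans n k l m (A : 'M['F_2]_(k, n)) (B : 'M['F_2]_(l, n))
  (C : 'M['F_2]_(m, n)) :
  code_equiv A B -> code_equiv B C -> code_equiv A C.
Proof.
case=> s sAB [t tBC]; exists (s * t)%g.
by rewrite perm_mxM mulmxA; apply: eqmx_trans (eqmxMr _ sAB) tBC.
Qed.

Lemma eqmx_code_equiv n k l (A : 'M['F_2]_(k, n)) (B : 'M['F_2]_(l, n)) :
  (A :=: B)%MS -> code_equiv A B.
Proof. by move=> AB; exists 1%g; rewrite perm_mx1 mulmx1. Qed.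

Lemma nth_bits_add u v i :
  nth false (bits_add u v) i = nth false u i (+) nth false v i.
Proof.
elim: u v i => [|a u IHu] [|b v] [|i] //=; rewrite ?nth_nil ?addbF //.
Qed.

Lemma natr_addb (a b : bool) : (a (+) b)%:R = a%:R + b%:R :> 'F_2.
Proof. by case: a; case: b => //=; apply: val_inj. Qed.

Lemma bitrow_add n u v : bitrow n (bits_add u v) = bitrow n u + bitrow n v.
Proof. by apply/rowP => i; rewrite !mxE nth_bits_add natr_addb. Qed.

Lemma bitrow_eq0 n u : true \notin u -> bitrow n u = 0.
Proof.
move=> uF; apply/rowP => i; rewrite !mxE.
have [lt_iu|le_ui] := ltnP i (size u); last by rewrite nth_default.
by have := mem_nth false lt_iu; case: (nth _ _ _) => // /(negP uF).
Qed.

Lemma span_code_cons n u G :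
  (span_code n (u :: G) :=: bitrow n u + span_code n G)%MS.
Proof.
by rewrite /span_code big_cons; apply: adds_eqmx => //; apply: genmxE.
Qed.

Lemma perm_span_code n G H : perm_eq G H -> span_code n G = span_code n H.
Proof. by move=> GH; apply: perm_big. Qed.

Lemma bitrow_sub_span n G u : u \in G -> (bitrow n u <= span_code n G)%MS.
Proof.
elim: G => // v G IHG; rewrite inE span_code_cons => /orP[/eqP->|/IHG uG].
  exact: addsmxSl.
exact: submx_trans uG (addsmxSr _ _).
Qed.

Lemma span_code_sub n G m (A : 'M['F_2]_(m, n)) :
  (forall u, u \in G -> (bitrow n u <= A)%MS) -> (span_code n G <= A)%MS.
Proof.
elim: G => [|u G IHG] uA; first by rewrite /span_code big_nil sub0mx.
rewrite span_code_cons addsmx_sub uA ?mem_head //=.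
by apply: IHG => v vG; apply: uA; rewrite inE vG orbT.
Qed.

Lemma reduce_span n B u :
  (bitrow n u - bitrow n (reduce B u) <= span_code n B)%MS.
Proof.
elim: B u => [|b B IHB] u /=; first by rewrite subrr sub0mx.
rewrite span_code_cons.
have IHv v := submx_trans (IHB v) (addsmxSr (bitrow n b) _).
case: ifP => _; last exact: IHv.
have /= := IHv (bits_add u b); rewrite bitrow_add => IHub.
rewrite -[bitrow n u](addrK (bitrow n b)) addrAC.
by apply: addmx_sub IHub _; rewrite (eqmx_opp _) addsmxSl.
Qed.

Lemma span_add_generator n B u :
  (span_code n (add_generator B u) :=: bitrow n u + span_code n B)%MS.
Proof.
have uB := reduce_span n B u; rewrite /add_generator.
set w := reduce B u in uB *.
(* Reducing [u] modulo [B] does not change the sum with the span of [B]. *)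
have uwB : (bitrow n u + span_code n B :=: bitrow n w + span_code n B)%MS.
  apply/eqmxP/andP; split; rewrite addsmx_sub addsmxSr andbT.
    rewrite -[bitrow n u](subrK (bitrow n w)).
    by rewrite addmx_sub ?addsmxSl // (submx_trans uB) ?addsmxSr.
  rewrite -[bitrow n w](subKr (bitrow n u)).
  by rewrite addmx_sub ?addsmxSl // eqmx_opp (submx_trans uB) ?addsmxSr.
apply: eqmx_trans (eqmx_sym uwB).
case: ifPn => [_|/bitrow_eq0 w0]; last by rewrite w0; apply/eqmx_sym/adds0mx.
have /permPl/perm_span_code-> := perm_sort (fun a b => ~~ bits_lt b a)
  (w :: [seq if pivot_bit w b then bits_add b w else b | b <- B]).
apply: eqmx_trans (span_code_cons _ _ _) _.
apply/eqmxP/andP; split; rewrite addsmx_sub addsmxSl.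
  apply: span_code_sub => _ /mapP[b /(bitrow_sub_span n) bB ->].
  have bwB := submx_trans bB (addsmxSr (bitrow n w) _).
  by case: ifP => // _; rewrite bitrow_add addmx_sub ?addsmxSl.
apply: span_code_sub => b bB.
set b' := if pivot_bit w b then bits_add b w else b.
have b'B : (bitrow n b' <= bitrow n w
    + span_code n [seq if pivot_bit w b then bits_add b w else b | b <- B])%MS.
  by apply: submx_trans (addsmxSr _ _); apply/bitrow_sub_span/map_f.
move: b'B; rewrite /b'; case: ifP => // _; rewrite bitrow_add => b'B.
rewrite -[bitrow n b](addrK (bitrow n w)).
by rewrite addmx_sub // eqmx_opp addsmxSl.
Qed.

Lemma span_echelon n G : (span_code n (echelon G) :=: span_code n G)%MS.
Proof.
suff gen B : (span_code n (foldl add_generator B G)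
    :=: span_code n G + span_code n B)%MS.
  apply: eqmx_trans (gen [::]) _.
  by rewrite {2}/span_code big_nil; apply: addsmx0.
elim: G B => [|u G IHG] B /=.
  by rewrite /(span_code n [::]) big_nil; apply/eqmx_sym/adds0mx.
apply: eqmx_trans (IHG _) _.
apply: eqmx_trans (adds_eqmx (eqmx_refl _) (span_add_generator n B u)) _.
apply: eqmx_sym.
apply: eqmx_trans (adds_eqmx (span_code_cons n u G) (eqmx_refl _)) _.
by rewrite (addsmxC (bitrow n u)) addsmxA.
Qed.

Lemma permute_span n p G : perm_eq p (iota 0 n) ->
  code_equiv (span_code n G) (span_code n [seq permute p u | u <- G]).
Proof.
move=> p_perm; have sz_p : size p = n by rewrite (perm_size p_perm) size_iota.
have ltp (i : 'I_n) : (nth 0%N p i < n)%N.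
  have: nth 0%N p i \in iota 0 n by rewrite -(perm_mem p_perm) mem_nth ?sz_p.
  by rewrite mem_iota.
have inj_t : injective (fun i => Ordinal (ltp i)).
  move=> i j /(congr1 val)/= /eqP.
  rewrite nth_uniq ?sz_p ?(perm_uniq p_perm) ?iota_uniq //.
  by move=> /eqP /val_inj.
have permuteE u :
    bitrow n (permute p u) = bitrow n u *m perm_mx (perm inj_t)^-1.
  rewrite -col_permE; apply/rowP => i; rewrite !mxE permE /=.
  by rewrite (nth_map 0%N) ?sz_p.
exists (perm inj_t)^-1%g; elim: G => [|u G IHG].
  by rewrite /span_code !big_nil mul0mx.
apply: eqmx_trans (eqmxMr _ (span_code_cons n u G)) _.
apply: eqmx_trans (addsmxMr _ _ _) _; rewrite -permuteE.
apply: eqmx_trans (adds_eqmx (eqmx_refl _) IHG) _.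
exact/eqmx_sym/span_code_cons.
Qed.

Lemma descend_equiv n moves fuel G :
  (forall p, p \in moves -> perm_eq p (iota 0 n)) ->
  code_equiv (span_code n G) (span_code n (descend moves fuel G)).
Proof.
move=> moves_perm; elim: fuel G => [|fuel IHf] G /=.
  exact: code_equiv_refl.
set L := [seq H <- _ | _].
have LP H : H \in L -> code_equiv (span_code n G) (span_code n H).
  rewrite mem_filter => /andP[_ /mapP[p /moves_perm p_perm ->]].
  apply: code_equiv_trans (permute_span G p_perm) _.
  exact/eqmx_code_equiv/eqmx_sym/span_echelon.
case: L LP => [|H L] LP; first exact: code_equiv_refl.
by apply: code_equiv_trans (LP H (mem_head _ _)) (IHf H).
Qed.

Lemma normal_form_equiv G :
  code_equiv (span_code 8 G) (span_code 8 (normal_form G)).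
Proof.
apply: code_equiv_trans (descend_equiv (moves := adjacent_swaps 8) 50 _ _).
  exact/eqmx_code_equiv/eqmx_sym/span_echelon.
by apply/allP; vm_compute.
Qed.

Definition support_classes : seq (seq (seq bool)) :=
  [seq normal_form (support_code m) | m <- supports].

(** A finite computation: nineteen codes, each extended by the 128 even words. *)
Lemma support_classes_closed : one_step_closed support_classes.
Proof. by vm_compute. Qed.

Lemma one_step_closedP Cs C u :
    one_step_closed Cs -> C \in Cs -> size u = 8%N -> ~~ odd (count id u) ->
  exists2 C', C' \in Cs &
    code_equiv (bitrow 8 u + span_code 8 C)%MS (span_code 8 C').
Proof.
move=> /allP/(_ C) Cs_closed CCs sz_u even_u.
have bit_listsP n w : size w = n -> w \in bit_lists n.
  elim: n w => [|n IHn] [|b w] //= [/IHn w_n].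
  rewrite cats0 mem_cat.
  by case: b; rewrite [X in _ || X]map_f ?orbT // || rewrite map_f.
have uE : u \in even_bit_lists by rewrite mem_filter even_u bit_listsP.
have /Cs_closed/allP/(_ (add_generator C u)) := CCs.
rewrite mem_undup map_f // => /(_ isT).
set a := fun k => _ => lt_a8.
have /hasP[k _ nf_Cs] : has a (iota 0 8) by rewrite has_find.
exists (normal_form
  [seq permute (rot k (iota 0 8)) w | w <- add_generator C u]).
  exact: nf_Cs.
apply: code_equiv_trans (normal_form_equiv _).
have rot_perm : perm_eq (rot k (iota 0 8)) (iota 0 8) by rewrite perm_rot.
apply: code_equiv_trans (permute_span _ rot_perm).
exact/eqmx_code_equiv/eqmx_sym/span_add_generator.
Qed.

Lemma bitrow_surj n (x : 'rV['F_2]_n) :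
  bitrow n [seq x 0 i == 1 | i <- enum 'I_n] = x.
Proof.
apply/rowP => i; rewrite mxE (nth_map i) ?size_enum_ord // nth_ord_enum.
by case: (x 0 i) => [] [|[|]] //= lt2; apply: val_inj.
Qed.

Lemma even_weight n (x : 'rV['F_2]_n) : x *m const_mx 1 = 0 :> 'M_1 ->
  ~~ odd (count id [seq x 0 i == 1 | i <- enum 'I_n]).
Proof.
move=> /matrixP/(_ 0 0); rewrite !mxE => x_even.
rewrite -dvdn2 (dvdn_pcharf (pchar_Fp (isT : prime 2))) -sumn_count.
rewrite -map_comp sumnE big_map big_enum /= natr_sum.
rewrite -[X in _ == X]x_even; apply/eqP; apply: eq_bigr => i _.
rewrite !mxE mulr1.
by case: (x 0 i) => [] [|[|]] //= lt2; apply: val_inj.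
Qed.

Lemma sum_rows_eqmx k n (A : 'M['F_2]_(k, n)) : (\sum_i <<row i A>> :=: A)%MS.
Proof.
apply/eqmxP/andP; split.
  by apply/sumsmx_subP => i _; rewrite genmxE row_sub.
by apply/row_subP => i; apply: (sumsmx_sup i); rewrite ?genmxE.
Qed.

(** Induction on a list of generators: the code spanned by the all-ones word is
    one of the nineteen, and each further generator is one step, to which
    [support_classes_closed] applies. *)
Lemma even_code_classification k (A : 'M['F_2]_(k, 8)) :
    A *m const_mx 1 = 0 :> 'cV_k ->
  exists2 m, m \in supports &
    code_equiv ((const_mx 1 : 'rV_8) + A)%MS (span_code 8 (support_code m)).
Proof.
move=> A_even.
suff [C /mapP[m m_in ->] eqAC] : exists2 C, C \in support_classes &
    code_equiv ((const_mx 1 : 'rV_8) + A)%MS (span_code 8 C).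
  exists m => //; apply: code_equiv_trans eqAC _.
  exact/code_equiv_sym/normal_form_equiv.
have rows_even : forall x, x \in [seq row i A | i : 'I_k] ->
    x *m const_mx 1 = 0 :> 'M_1.
  by move=> _ /mapP[i _ ->]; rewrite -row_mul A_even row0.
suff [C CCs [s sC]] : exists2 C, C \in support_classes & code_equiv
    ((const_mx 1 : 'rV_8) + \sum_(x <- [seq row i A | i : 'I_k]) <<x>>)%MS
    (span_code 8 C).
  exists C; first exact: CCs.
  exists s; apply: eqmx_trans sC.
  apply: eqmxMr; apply: adds_eqmx (eqmx_refl _) _.
  by rewrite big_image; apply/eqmx_sym/sum_rows_eqmx.
elim: {A A_even}[seq row i A | i : 'I_k] rows_even => [|x xs IHxs] xs_even.
  (* The code spanned by the all-ones word is that of the last model. *)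
  exists (normal_form (support_code (nseq 8 [::]))).
    have supp8 : nseq 8 [::] \in supports by vm_compute.
    exact: (map_f (fun m => normal_form (support_code m)) supp8).
  apply: code_equiv_trans (normal_form_equiv _); apply: eqmx_code_equiv.
  rewrite big_nil; apply: eqmx_trans (addsmx0 _ _) _.
  have bits1 : bitrow 8 (nseq 8 true) = const_mx 1.
    by apply/rowP => i; rewrite !mxE nth_nseq ltn_ord.
  apply/eqmxP/andP; split.
    by rewrite -bits1; apply: bitrow_sub_span; rewrite mem_head.
  apply: span_code_sub => u; rewrite inE => /predU1P[->|].
    by rewrite bits1.
  move=> /mapP[c _ ->]; rewrite bitrow_eq0 ?sub0mx //.
have [|C CCs [s sC]] := IHxs.
  by move=> y yxs; apply: xs_even; rewrite inE yxs orbT.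
have x_even : x *m perm_mx s *m const_mx 1 = 0 :> 'M_1.
  have perm1 : perm_mx s *m const_mx 1 = const_mx 1 :> 'cV['F_2]_8.
    by rewrite -row_permE; apply/matrixP => i j; rewrite !mxE.
  by rewrite -mulmxA perm1; apply: xs_even; apply: mem_head.
have [|C' C'Cs eqC] :=
  one_step_closedP support_classes_closed CCs _ (even_weight x_even).
  by rewrite size_map size_enum_ord.
exists C'; first exact: C'Cs.
apply: code_equiv_trans eqC; exists s.
rewrite bitrow_surj big_cons addsmxA (addsmxC (const_mx 1)) -addsmxA.
apply: eqmx_trans (addsmxMr _ _ _) _.
by apply: adds_eqmx; [apply/eqmxMr/genmxE | exact: sC].
Qed.

(** * Vertex matrices with equivalent codes *)

Lemma intr_F2_eq0 (z : int) : (z%:~R == 0 :> 'F_2) = (2 %| z)%Z.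
Proof. by rewrite (dvdz_pcharf (pchar_Fp (isT : prime 2))). Qed.

Definition mod2_mx k l (A : 'M[int]_(k, l)) : 'M['F_2]_(k, l) := map_mx intr A.

Lemma even_mx_half k l (X : 'M[int]_(k, l)) :
  mod2_mx X = 0 -> exists Y, X = 2%:Z *: Y.
Proof.
move=> X0; exists (\matrix_(i, j) (X i j %/ 2)%Z).
apply/matrixP => i j; rewrite !mxE mulrC divzK //.
by rewrite -intr_F2_eq0; move/matrixP/(_ i j): X0; rewrite !mxE => ->.
Qed.

Lemma halve_mx_inj m n : injective (fun A : 'M[int]_(m, n) => 2%:Z *: A).
Proof.
move=> A B /matrixP AB; apply/matrixP => i j.
by have := AB i j; rewrite !mxE => /(mulfI (isT : 2%:Z != 0)).
Qed.

Lemma mx_F2_two m n (A : 'M[int]_(m, n)) :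
  mod2_mx (2%:Z *: A) = 0.
Proof.
apply/matrixP => i j; rewrite !mxE rmorphM /=.
by rewrite [2%:~R](_ : _ = 0) ?mul0r //; apply: val_inj.
Qed.

(** The candidate is M = V^-1 P S = (W P S) / 2.  Modulo 2 the columns of P^-1 V
    and those of S span the same space, and W V = 2 kills the columns of V;
    hence W P S is even and M is integral.  Exchanging the two matrices shows
    that M^-1 = (T P^-1 V) / 2 is integral too. *)
Lemma unimodular_of_codes n (V W S T : 'M[int]_n) (s : 'S_n) :
    V *m W = 2%:M -> W *m V = 2%:M -> S *m T = 2%:M -> T *m S = 2%:M ->
    ((mod2_mx V)^T *m perm_mx s :=: (mod2_mx S)^T)%MS ->
  exists2 M, M \in unitmx & V *m M = perm_mx s *m S.
Proof.
move=> VW WV ST TS eqVS; pose P : 'M[int]_n := perm_mx s.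
pose P' : 'M[int]_n := perm_mx s^-1.
have PP' : P *m P' = 1%:M by rewrite -perm_mxM mulgV perm_mx1.
have P'P : P' *m P = 1%:M by rewrite -perm_mxM mulVg perm_mx1.
pose F2 (A : 'M[int]_n) := mod2_mx A.
have F2M A B : F2 (A *m B) = F2 A *m F2 B by exact: map_mxM.
have F2P'V : (F2 (P' *m V))^T = (F2 V)^T *m perm_mx s.
  by rewrite F2M trmx_mul [F2 P']map_perm_mx tr_perm_mx invgK.
have [C1 SE] : exists C, F2 S = F2 (P' *m V) *m C.
  have /submxP[C /(congr1 trmx)] : ((F2 S)^T <= (F2 (P' *m V))^T)%MS.
    by rewrite F2P'V eqVS.
  by rewrite trmx_mul !trmxK => ->; exists C^T.
have [C2 VE] : exists C, F2 (P' *m V) = F2 S *m C.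
  have /submxP[C /(congr1 trmx)] : ((F2 (P' *m V))^T <= (F2 S)^T)%MS.
    by rewrite F2P'V eqVS.
  by rewrite trmx_mul !trmxK => ->; exists C^T.
have two0 : F2 2%:M = 0 by rewrite -[2%:M]scalemx1 [F2 _]mx_F2_two.
have [M ME] : exists M, W *m P *m S = 2%:Z *: M.
  apply: even_mx_half; rewrite [mod2_mx _]F2M SE mulmxA -F2M.
  by rewrite mulmxA -[W *m P *m P']mulmxA PP' mulmx1 WV two0 mul0mx.
have [M' M'E] : exists M, T *m P' *m V = 2%:Z *: M.
  apply: even_mx_half; rewrite -mulmxA [mod2_mx _]F2M VE mulmxA -F2M.
  by rewrite TS two0 mul0mx.
exists M.
  suff /mulmx1_unit[] : M *m M' = 1%:M by [].
  apply/halve_mx_inj/halve_mx_inj; rewrite /= scalemxAr -M'E scalemxAl -ME.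
  rewrite -[W *m P *m S]mulmxA -mulmxA -!mulmxA (mulmxA S) ST.
  rewrite mul_scalar_mx -!scalemxAr (mulmxA P) PP' mul1mx WV.
  by rewrite scalemx1.
apply: halve_mx_inj; rewrite /= scalemxAr -ME !mulmxA VW mul_scalar_mx.
by rewrite scalemxAl.
Qed.

Lemma map_hom_mx (R R' : nzRingType) (f : {rmorphism R -> R'}) n d
    (v : 'I_n -> 'rV[R]_d) :
  map_mx f (hom_mx v) = hom_mx (fun i => map_mx f (v i)).
Proof.
apply/row_matrixP => i; rewrite -map_row !rowK map_row_mx; congr row_mx.
exact: map_mx1.
Qed.

Lemma hom_mxE (R : nzRingType) n d (v : 'I_n -> 'rV[R]_d) :
  hom_mx v = row_mx (const_mx 1) (\matrix_i v i).
Proof.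
apply/row_matrixP => i; rewrite rowK row_row_mx rowK; congr row_mx.
by apply/rowP => j; rewrite (ord1 j) !mxE.
Qed.

(** Both vertex matrices have a first column of ones, so the unimodular matrix
    that relates them fixes the first coordinate: it is an affine map. *)
Lemma unimod_equiv_of_codes (R : realType) d (v u : 'I_(1 + d) -> 'rV[int]_d)
    (W T : 'M[int]_(1 + d)) (s : 'S_(1 + d)) :
    hom_mx v *m W = 2%:M -> W *m hom_mx v = 2%:M ->
    hom_mx u *m T = 2%:M -> T *m hom_mx u = 2%:M ->
    ((mod2_mx (hom_mx v))^T *m perm_mx s :=: (mod2_mx (hom_mx u))^T)%MS ->
  unimod_equiv (conv (range (fun i => map_mx intr (v i) : 'rV[R]_d)))
    (conv (range (fun i => map_mx intr (u i)))).
Proof.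
move=> VW WV ST TS eqVS.
have [M M_unit VM] := unimodular_of_codes VW WV ST TS eqVS.
have M1 : lsubmx M = col_mx 1 0.
  have V1 : hom_mx v *m lsubmx M = hom_mx v *m col_mx 1 0.
    have <- : lsubmx (hom_mx v *m M) = hom_mx v *m lsubmx M.
      by rewrite -[M in LHS]hsubmxK mul_mx_row row_mxKl.
    rewrite VM hom_mxE mul_mx_row row_mxKl hom_mxE mul_row_col mulmx1 mulmx0.
    by rewrite addr0 -row_permE; apply/matrixP => i j; rewrite !mxE.
  have /(congr1 (mulmx W)) := V1; rewrite !mulmxA WV !mul_scalar_mx.
  exact: halve_mx_inj.
pose U := dsubmx (rsubmx M); pose w := usubmx (rsubmx M).
have ME : M = affine_mx U w.
  by rewrite /affine_mx block_mxEh vsubmxK -M1 hsubmxK.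
exists U, w; split.
  by apply: unimodularP; move: M_unit; rewrite ME unitmxE det_ublock det1 mul1r.
rewrite image_conv_range; congr conv.
have uE i : map_mx intr (u (s i)) = map_mx intr (v i) *m map_mx intr U
    + map_mx intr w :> 'rV[R]_d.
  rewrite -map_mxM -map_mxD; congr map_mx.
  move: VM; rewrite {1}ME -hom_mx_affine -row_permE => /row_matrixP/(_ i).
  have -> : row i (row_perm s (hom_mx u)) = row (s i) (hom_mx u).
    by apply/rowP => j; rewrite !mxE.
  by rewrite !rowK => /eq_row_mx[_ ->].
apply/seteqP; split=> [_ [i _ <-]|_ [i _ <-]]; last by exists (s i).
by exists (s^-1 i)%g; rewrite // -uE permKV.
Qed.

(** * The nineteen model simplices *)

(** In all nineteen simplices an even nonzero coefficient of a vertex other than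
    the origin is 2 and stands at the index of the vertex itself; it is there
    exactly when this index is not in the support. *)
Definition model_entry (m : seq (seq nat)) (i j : nat) : nat :=
  (j \in nth [::] m i) + 2 * ((j == i) && (j \notin nth [::] m i)).

Definition model_vertex (m : seq (seq nat)) (i : nat) : 'rV[int]_7 :=
  \row_(j < 7) Posz (model_entry m i j.+1).

Lemma nineteen_vertex_listsE (R : realType) :
  nineteen_vertex_lists R =
  [seq [seq map_mx intr (model_vertex m i) | i <- iota 0 8] | m <- supports].
Proof.
rewrite /nineteen_vertex_lists /supports [iota 0 8]/= !map_cons.
do ?[apply: (congr2 cons)] => //.
all: apply/rowP=> -[j lt_j7]; rewrite !mxE /model_entry /=.
all: case: j lt_j7 => [|[|[|[|[|[|[|//]]]]]]] lt_j7.
all: by rewrite /= ?mulr0 ?mulr1 ?addr0 ?add0r.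
Qed.

(** The relation is (S0 - 1) (S0 - 2) = 0: each row of [S0] is its own unit
    vector, or twice its own unit vector plus other unit vectors that are rows
    of [S0]. *)
Lemma model_quadratic m : m \in supports ->
  let S0 := \matrix_(i < 7) model_vertex m i.+1 in
  S0 *m S0 + 2%:M = 3%:Z *: S0.
Proof.
move=> m_in S0.
have /allP/(_ m m_in)/allP check : all (fun m => all (fun i => all (fun k =>
    sumn [seq model_entry m i.+1 c.+1 * model_entry m c.+1 k.+1 | c <- iota 0 7]
      + 2 * (i == k) == 3 * model_entry m i.+1 k.+1)%N
    (iota 0 7)) (iota 0 7)) supports by vm_compute.
apply/matrixP => i k.
have eq_ik : (sumn [seq model_entry m i.+1 c.+1 * model_entry m c.+1 k.+1
    | c <- iota 0 7] + 2 * (val i == val k) = 3 * model_entry m i.+1 k.+1)%N.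
  have i_in : val i \in iota 0 7 by rewrite mem_iota ltn_ord.
  have k_in : val k \in iota 0 7 by rewrite mem_iota ltn_ord.
  exact/eqP/(allP (check _ i_in) _ k_in).
move/(congr1 Posz): eq_ik; rewrite PoszD !PoszM sumnE big_map => eq_ik.
rewrite !mxE -eq_ik; congr (_ + _); last first.
  by rewrite -val_eqE; case: (_ == _).
rewrite -[iota 0 7]/(index_iota 0 7) big_mkord (big_morph Posz PoszD (erefl _)).
by apply: eq_bigr => c _; rewrite !mxE PoszM.
Qed.

(** By [model_quadratic], 3 - S0 is twice the inverse of S0. *)
Lemma model_inverse m : m \in supports ->
  exists2 T : 'M[int]_(1 + 7),
    hom_mx (fun i : 'I_(1 + 7) => model_vertex m i) *m T = 2%:M &
    T *m hom_mx (fun i : 'I_(1 + 7) => model_vertex m i) = 2%:M.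
Proof.
move=> m_in; have := model_quadratic m_in.
set S0 := \matrix_i _ => /= quad.
have v0 : model_vertex m 0 = 0.
  apply/rowP => j; rewrite !mxE; congr Posz; move: (val j).
  have: all (fun m => nth [::] m 0 == [::]) supports by vm_compute.
  by move=> /allP/(_ m m_in)/eqP m0 k; rewrite /model_entry m0.
pose T0 : 'M[int]_7 := 3%:M - S0.
have ST0 : S0 *m T0 = 2%:M.
  by rewrite mulmxBr mul_mx_scalar -quad addrC addKr.
have TS0 : T0 *m S0 = 2%:M.
  by rewrite mulmxBl mul_scalar_mx -quad addrC addKr.
have SE : hom_mx (fun i : 'I_(1 + 7) => model_vertex m i) =
    block_mx 1%:M 0 (const_mx 1) S0 :> 'M[int]_(1 + 7).
  apply/row_matrixP => i; rewrite rowK.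
  case: (split_ordP i) => j ->.
    rewrite (ord1 j) v0 /block_mx; apply/rowP => k.
    by rewrite [RHS]mxE col_mxEu.
  rewrite /block_mx; apply/rowP => k; rewrite [RHS]mxE col_mxEd.
  by case: (split_ordP k) => l ->; rewrite ?row_mxEl ?row_mxEr !mxE ?(ord1 l).
exists (block_mx 2%:M 0 (- (T0 *m const_mx 1)) T0 : 'M_(1 + 7)).
  rewrite SE mulmx_block.
  rewrite !mul1mx !mulmx0 !mul0mx !addr0 add0r mulmxN mulmxA ST0.
  rewrite mul_mx_scalar mul_scalar_mx.
  by rewrite subrr [RHS](scalar_mx_block 1 7).
rewrite SE mulmx_block !mulmx1 !mulmx0 !mul0mx !addr0 add0r addNr TS0.
by rewrite [RHS](scalar_mx_block 1 7).
Qed.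

Lemma model_code m : m \in supports ->
  ((mod2_mx (hom_mx (fun i : 'I_(1 + 7) => model_vertex m i)))^T
    :=: span_code 8 (support_code m))%MS.
Proof.
move=> m_in; have sz_m : size m = 8%N.
  have: all (fun m => size m == 8%N) supports by vm_compute.
  by move=> /allP/(_ m m_in)/eqP.
set A := (_)^T.
have A0 : row (lshift 7 0) A = bitrow 8 (nseq 8 true).
  apply/rowP => i; rewrite 3![LHS]mxE [hom_mx _ _ _]mxE row_mxEl !mxE.
  by rewrite nth_nseq ltn_ord.
have Aj (j : 'I_7) : row (rshift 1 j) A = bitrow 8 [seq j.+1 \in r | r <- m].
  apply/rowP => i; rewrite 3![LHS]mxE [hom_mx _ _ _]mxE row_mxEr !mxE.
  rewrite (nth_map [::]) ?sz_m //.
  rewrite /model_entry PoszD rmorphD PoszM rmorphM /= [X in X * _](_ : _ = 0).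
    by rewrite mul0r addr0; case: (_ \in _).
  exact: val_inj.
apply/eqmxP/andP; split.
  apply/row_subP => i; case: (split_ordP i) => j ->.
    by rewrite (ord1 j) A0 bitrow_sub_span // mem_head.
  rewrite Aj; apply: bitrow_sub_span; rewrite inE; apply/orP; right.
  have j_in : j.+1 \in iota 1 7 by rewrite mem_iota; apply: (ltn_ord j).
  exact: (map_f (fun c => [seq c \in r | r <- m]) j_in).
apply: span_code_sub => u; rewrite inE => /predU1P[->|/mapP[c]].
  by rewrite -A0 row_sub.
rewrite mem_iota; case: c => // c lt_c ->.
by rewrite -(Aj (Ordinal (lt_c : c < 7)%N)) row_sub.
Qed.

(** * The classification *)

Lemma map_intr_mx_inj (R : realType) m n :
  injective (fun A : 'M[int]_(m, n) => map_mx intr A : 'M[R]_(m, n)).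
Proof.
move=> A B /matrixP AB; apply/matrixP => i j.
by have := AB i j; rewrite !mxE => /intr_inj.
Qed.

Theorem theorem4p20 (R : realType) (D : set 'rV[R]_7)
  (D_lattice : lattice_polytope D) (D_simplex : simplex D)
  (D_dim : has_dim D 7) (D_gorenstein : gorenstein D) (D_deg : deg D = 4%N)
  (D_not_pyramid : ~ lattice_pyramid D) :
  exists2 s : seq 'rV[R]_7,
    s \in nineteen_vertex_lists R & unimod_equiv D (conv [set` s]).
Proof.
have [v v_unit DE] := simplex_vertices D_simplex D_dim.
have v_int i : lattice_point (v i).
  by apply: (D_lattice.2); rewrite DE; apply: simplex_vertex.
have codegD : codeg D = 4%N.
  by move: D_deg; rewrite /deg; case: (codeg D) => [|[|[|[|[|[|[|[|[|]]]]]]]]].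
rewrite {D}DE in D_lattice D_simplex D_dim D_gorenstein D_deg D_not_pyramid
  codegD *.
have [|p p_int] :=
  gorenstein_codeg_weights (isT : (0 < 7)%N) v_unit v_int D_gorenstein.
  by rewrite codegD.
set K := invmx _; rewrite codegD; set b := fun i => _.
case=> b_gt0 b_sum Kb_int bV_int.
have b_half i : b i = 2^-1.
  apply: half_weights => // {}i; apply/eqP => bi1; apply: D_not_pyramid.
  apply: (lattice_pyramid_of_apex (d := 6) (i := i) v_unit v_int) => k.
  by have := Kb_int k i; rewrite -/(b i) bi1 divr1.
have [z zE] : exists z : 'I_8 -> 'rV[int]_7, v = fun i => map_mx intr (z i).
  have /choice[z zE] i : exists zi : 'rV[int]_7, v i = map_mx intr zi.
    by apply: int_mxP => a j; rewrite (ord1 a); apply: v_int.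
  by exists z; apply/funext.
have [W WE] : exists W : 'M[int]_8, 2 *: K = map_mx intr W.
  apply: int_mxP => k i; rewrite mxE mulrC.
  by have := Kb_int k i; rewrite -/(b i) b_half invrK.
have two_mx : (2 : R)%:M = map_mx intr (2%:M : 'M[int]_8).
  by rewrite map_scalar_mx.
have zW : hom_mx z *m W = 2%:M.
  apply: (@map_intr_mx_inj R).
  rewrite -two_mx map_mxM -WE map_hom_mx -zE -scalemxAr mulmxV //.
  by rewrite scalemx1.
have Wz : W *m hom_mx z = 2%:M.
  apply: (@map_intr_mx_inj R).
  rewrite -two_mx map_mxM -WE map_hom_mx -zE -scalemxAl mulVmx //.
  by rewrite scalemx1.
have [pz pE] : exists pz : 'rV[int]_7, p = map_mx intr pz.
  by apply: int_mxP => a j; rewrite (ord1 a); apply: p_int.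
(* The weights 1/2 are the barycentric coordinates of (4, p). *)
have ones_even : const_mx 1 *m hom_mx z = 2%:Z *: row_mx 4%:M pz.
  apply: (@map_intr_mx_inj R).
  have bE : 2 *: (row_mx 4%:M p *m K) = const_mx 1.
    apply/rowP => i; rewrite !mxE -[\sum_j _]/(_ : R).
    by have := b_half i; rewrite /b mxE => ->; rewrite divff ?pnatr_eq0.
  rewrite map_mxM map_hom_mx -zE map_const_mx rmorph1 -bE.
  rewrite -scalemxAl mulmxKV // map_mxZ map_row_mx map_scalar_mx -pE.
  by [].
pose A := (mod2_mx (\matrix_i z i))^T.
have codeE : (mod2_mx (hom_mx z))^T = col_mx (const_mx 1) A.
  rewrite hom_mxE /mod2_mx map_row_mx tr_row_mx map_const_mx trmx_const.
  by rewrite rmorph1.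
have A_even : A *m const_mx 1 = 0 :> 'cV_7.
  have := mx_F2_two (row_mx 4%:M pz); rewrite -ones_even /mod2_mx map_mxM.
  move/(congr1 trmx); rewrite trmx_mul [(map_mx _ (hom_mx z))^T]codeE.
  rewrite map_const_mx trmx_const rmorph1 mul_col_mx trmx0 -[RHS]col_mx0.
  by case/eq_col_mx.
have [m m_in [s sE]] := even_code_classification A_even.
have [T ST TS] := model_inverse m_in.
exists [seq map_mx intr (model_vertex m i) | i <- iota 0 8].
  by rewrite nineteen_vertex_listsE; apply: map_f m_in.
have -> : [set` [seq map_mx intr (model_vertex m i) | i <- iota 0 8]] =
    range (fun i : 'I_8 => map_mx intr (model_vertex m i) : 'rV[R]_7).
  apply/seteqP; split=> [x /mapP[i]|_ [i _ <-]].
    by rewrite mem_iota => lt_i8 ->; exists (Ordinal (lt_i8 : i < 8)%N).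
  apply: (map_f (fun k => map_mx intr (model_vertex m k))).
  by rewrite mem_iota; apply: (ltn_ord i).
rewrite zE.
apply: (@unimod_equiv_of_codes R 7 z (fun i => model_vertex m i) W T s) => //.
apply: eqmx_trans (eqmx_sym (model_code m_in)).
apply: eqmx_trans sE; apply: eqmxMr; rewrite codeE.
exact/eqmx_sym/addsmxE.
Qed.
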